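(* Let $m\geq 3$ be odd, let $H_1$ and $H_2$ be simple $C_m$-trees and let $p_1,p_2\in(0,1)$ with $p_1+p_2=1$. Then $(H_1,H_2)$ is $(p_1,p_2)$-common if and only if \[\frac{e(H_1)-v(H_1)+1}{e(H_1)p_1^{m-1}}=\frac{e(H_2)-v(H_2)+1}{e(H_2)p_2^{m-1}}.\]
   Context: Graphs are finite and simple; $v(H)$ and $e(H)$ are the numbers of vertices and edges; $C_m$ is the cycle of length $m$. A graph $H$ is a simple $C_m$-tree if either $H=C_m$ or $H$ is obtained from a smaller simple $C_m$-tree $H'$ by adding a new copy of $C_m$ and identifying either one vertex of the new copy with one vertex of $H'$, or one edge of the new copy with one edge of $H'$. A graphon is a symmetric measurable $W:[0,1]^2\to[0,1]$, and $t(H,W):=\int_{[0,1]^{V(H)}}\prod_{uv\in E(H)}W(x_u,x_v)\prod_{v}dx_v$. For $p_1,p_2\in(0,1)$ with $p_1+p_2=1$, a pair $(H_1,H_2)$ of graphs with at least one edge each is $(p_1,p_2)$-common if for all graphons $W_1,W_2$ with $W_1+W_2=1$, \[\frac{t(H_1,W_1)}{e(H_1)p_1^{e(H_1)-1}}+\frac{t(H_2,W_2)}{e(H_2)p_2^{e(H_2)-1}}\geq \frac{p_1}{e(H_1)}+\frac{p_2}{e(H_2)}.\] *)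

(* Defs.v *)
From HB Require Import structures.
From mathcomp Require Import all_boot all_order all_algebra.
From mathcomp Require Import all_classical all_reals all_analysis.

Set Implicit Arguments.
Unset Strict Implicit.
Unset Printing Implicit Defensive.

Import Order.TTheory GRing.Theory Num.Theory.
Import numFieldNormedType.Exports.

Local Open Scope classical_set_scope.
Local Open Scope ring_scope.

Record sgraph := SGraph {
  vertex :> finType;
  adj : rel vertex;
  adj_sym : symmetric adj;
  adj_irrefl : irreflexive adj }.

Arguments adj {s} : rename.

Definition num_vertices (G : sgraph) : nat := #|G|.

(* An edge uv is represented by the one of the ordered pairs (u, v), (v, u)
   whose components are increasing in the enumeration of the vertices. *)
Definition edges (G : sgraph) : pred (G * G) :=
  [pred uv | adj uv.1 uv.2 && (enum_rank uv.1 < enum_rank uv.2)%N].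

Arguments edges : clear implicits.

Definition num_edges (G : sgraph) : nat := #|edges G|.

Definition graph_iso (G K : sgraph) : Prop :=
  exists2 f : G -> K, bijective f & forall x y, adj (f x) (f y) = adj x y.

(* The conjunct i != j only matters for m = 1. *)
Definition cycle_adj (m : nat) : rel 'I_m :=
  [rel i j | (i != j) && ((j == ordS i) || (i == ordS j))].

Lemma cycle_adj_sym m : symmetric (@cycle_adj m).
Proof. by move=> i j; rewrite /cycle_adj /= eq_sym orbC. Qed.

Lemma cycle_adj_irrefl m : irreflexive (@cycle_adj m).
Proof. by move=> i; rewrite /cycle_adj /= eqxx. Qed.

Definition cycle_graph (m : nat) : sgraph :=
  SGraph (@cycle_adj_sym m) (@cycle_adj_irrefl m).

Definition union_adj (G K : sgraph) : rel (G + K)%type :=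
  fun x y => match x, y with
             | inl u, inl v => adj u v
             | inr i, inr j => adj i j
             | _, _ => false
             end.

Lemma union_adj_sym G K : symmetric (@union_adj G K).
Proof. by move=> [u|i] [v|j] //=; rewrite adj_sym. Qed.

Lemma union_adj_irrefl G K : irreflexive (@union_adj G K).
Proof. by move=> [u|i] /=; rewrite adj_irrefl. Qed.

Definition disjoint_union (G K : sgraph) : sgraph :=
  SGraph (@union_adj_sym G K) (@union_adj_irrefl G K).

(* H is, up to isomorphism, the quotient of D obtained by identifying x with y
   for each (x, y) in s; q is the quotient map.  The pairs of s are assumed to
   be vertex-disjoint, so that the generated equivalence relation only relates
   x and y when x = y or one of (x, y), (y, x) is in s. *)
Definition identification (D : sgraph) (s : seq (D * D)) (H : sgraph) : Prop :=
  exists q : D -> H,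
    [/\ forall a, exists x, q x = a,
        forall x y, q x = q y <-> [\/ x = y, (x, y) \in s | (y, x) \in s]
      & forall a b, adj a b <-> exists x y, [/\ q x = a, q y = b & adj x y]].

Inductive simple_cycle_tree (m : nat) : sgraph -> Prop :=
| CycleTreeBase (H : sgraph) :
    graph_iso (cycle_graph m) H -> simple_cycle_tree m H
| CycleTreeVertex (H' H : sgraph) (u : H') (i : cycle_graph m) :
    simple_cycle_tree m H' ->
    @identification (disjoint_union H' (cycle_graph m))
      [:: (inl u, inr i)] H ->
    simple_cycle_tree m H
| CycleTreeEdge (H' H : sgraph) (u v : H') (i j : cycle_graph m) :
    simple_cycle_tree m H' -> adj u v -> adj i j ->
    @identification (disjoint_union H' (cycle_graph m))
      [:: (inl u, inr i); (inl v, inr j)] H ->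
    simple_cycle_tree m H.

Section lebesgue_tuple.
Variable R : realType.
Local Open Scope ereal_scope.

Definition tcons n (x : R * n.-tuple R) : n.+1.-tuple R :=
  [the n.+1.-tuple R of x.1 :: x.2].

(* Lebesgue measure on R^n: the n-fold product of the Lebesgue measure of R,
   transported to tuples along cons. *)
Fixpoint lebesgue_tuple n : set (n.-tuple R) -> \bar R :=
  if n is n'.+1 then
    pushforward (@lebesgue_measure R \x @lebesgue_tuple n') (@tcons n')
  else @dirac _ _ ([tuple] : 0.-tuple R) R.

Lemma measurable_tcons n : measurable_fun setT (@tcons n).
Proof. exact: measurable_cons. Qed.

Lemma measurable_tuncons n :
  measurable_fun setT (fun t : n.+1.-tuple R => (thead t, [tuple of behead t])).
Proof.
apply/measurable_fun_pairP; split => /=; first exact: measurable_tnth.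
exact: measurable_behead.
Qed.

Lemma pushforward_tcons_box n
    (m : {sigma_finite_measure set (n.-tuple R) -> \bar R})
    (A : set R) (B : set (n.-tuple R)) :
  measurable A -> measurable B ->
  pushforward (@lebesgue_measure R \x m) (@tcons n)
    [set t | A (thead t) /\ B [tuple of behead t]] = lebesgue_measure A * m B.
Proof.
move=> mA mB; rewrite -product_measure1E// /pushforward.
congr (product_measure1 _ _ _); apply/seteqP.
have tE (x : R) (t : n.-tuple R) : [tuple of behead (tcons (x, t))] = t.
  exact: val_inj.
by split => -[x t] /=; rewrite tE.
Qed.

Let sigma_finite_measure_of d (T : measurableType d) (nu : set T -> \bar R) :
  nu set0 = 0 -> (forall A, 0 <= nu A) -> semi_sigma_additive nu ->
  sigma_finite setT nu ->
  exists m : {sigma_finite_measure set T -> \bar R}, nu = m.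
Proof.
move=> nu0 nu_ge0 nu_sigma nu_sf.
pose H1 := isMeasure.Build _ _ _ nu nu0 nu_ge0 nu_sigma.
pose nu1 : {measure set T -> \bar R} := HB.pack nu H1.
pose H2 := Measure_isSigmaFinite.Build _ _ _ nu1 nu_sf.
pose nu2 : {sigma_finite_measure set T -> \bar R} := HB.pack nu H1 H2.
by exists nu2.
Qed.

Let lebesgue_tuple_measure n :
  exists m : {sigma_finite_measure set (n.-tuple R) -> \bar R},
    @lebesgue_tuple n = m.
Proof.
elim: n => [|n [m mE]]; first by exists (@dirac _ _ ([tuple] : 0.-tuple R) R).
pose mu := [the {measure set _ -> \bar R} of @lebesgue_measure R \x m].
pose nu : {measure set _ -> \bar R} :=
  measure_function_pushforward__canonical__measure_function_Measure mu
    (@measurable_tcons n).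
have nu_sf : sigma_finite setT nu.
  have /sigma_finiteP[F [TF ndF Foo]] := sigma_finiteT (@lebesgue_measure R).
  have /sigma_finiteP[G [TG ndG Goo]] := sigma_finiteT m.
  exists (fun k => [set t | F k (thead t) /\ G k [tuple of behead t]]).
    apply/seteqP; split=> // t _.
    have [i _ Fi] : (\bigcup_i F i) (thead t) by rewrite -TF.
    have [j _ Gj] : (\bigcup_i G i) [tuple of behead t] by rewrite -TG.
    exists (maxn i j) => //; split.
    - by move: Fi; exact/subsetPset/ndF/leq_maxl.
    - by move: Gj; exact/subsetPset/ndG/leq_maxr.
  move=> k; have [mF Fk] := Foo k; have [mG Gk] := Goo k; split.
    have := @measurable_tuncons n measurableT _ (measurableX mF mG).
    by rewrite setTI.
  by rewrite /nu [ltLHS]pushforward_tcons_box// lte_mul_pinfty// ge0_fin_numE.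
have [nu' nuE] := sigma_finite_measure_of (measure0 nu)
  (@measure_ge0 _ _ _ nu) (@measure_semi_sigma_additive _ _ _ nu) nu_sf.
by exists nu'; rewrite -nuE /= mE.
Qed.

Let lebesgue_tuple0 n : @lebesgue_tuple n set0 = 0.
Proof. by have [m ->] := lebesgue_tuple_measure n; rewrite measure0. Qed.

Let lebesgue_tuple_ge0 n A : 0 <= @lebesgue_tuple n A.
Proof. by have [m ->] := lebesgue_tuple_measure n. Qed.

Let lebesgue_tuple_semi_sigma_additive n :
  semi_sigma_additive (@lebesgue_tuple n).
Proof.
have [m ->] := lebesgue_tuple_measure n.
exact: measure_semi_sigma_additive.
Qed.

HB.instance Definition _ n := isMeasure.Build _ _ _ (@lebesgue_tuple n)
  (@lebesgue_tuple0 n) (@lebesgue_tuple_ge0 n)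
  (@lebesgue_tuple_semi_sigma_additive n).

Let lebesgue_tuple_sigma_finite n : sigma_finite setT (@lebesgue_tuple n).
Proof.
by have [m ->] := lebesgue_tuple_measure n; exact: sigma_finiteT.
Qed.

HB.instance Definition _ n := Measure_isSigmaFinite.Build _ _ _
  (@lebesgue_tuple n) (@lebesgue_tuple_sigma_finite n).

End lebesgue_tuple.

Section graphon.
Variable R : realType.

Definition graphon (W : R * R -> R) : Prop :=
  [/\ measurable_fun (`[0 : R, 1] `*` `[0 : R, 1]) W,
      forall x y, x \in `[0, 1] -> y \in `[0, 1] -> 0 <= W (x, y) <= 1
    & forall x y, x \in `[0, 1] -> y \in `[0, 1] -> W (x, y) = W (y, x)].

Definition unit_cube n : set (n.-tuple R) :=
  [set t | forall i, tnth t i \in `[0, 1]].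

(* The coordinates of [0, 1]^V(H) are indexed through enum_rank. *)
Definition hom_density (H : sgraph) (W : R * R -> R) : R :=
  \int[@lebesgue_tuple R #|H|]_(x in @unit_cube #|H|)
    \prod_(uv in edges H)
      W (tnth x (enum_rank uv.1), tnth x (enum_rank uv.2)).

Definition common_pair (p1 p2 : R) (H1 H2 : sgraph) : Prop :=
  [/\ (0 < num_edges H1)%N, (0 < num_edges H2)%N &
    forall W1 W2 : R * R -> R, graphon W1 -> graphon W2 ->
      (forall x y, x \in `[0, 1] -> y \in `[0, 1] ->
         W1 (x, y) + W2 (x, y) = 1) ->
      p1 / (num_edges H1)%:R + p2 / (num_edges H2)%:R <=
        hom_density H1 W1 / ((num_edges H1)%:R * p1 ^+ (num_edges H1 - 1)) +
        hom_density H2 W2 / ((num_edges H2)%:R * p2 ^+ (num_edges H2 - 1))].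

End graphon.

(* Main.v *)
Require Import Defs.
From mathcomp Require Import all_boot all_order all_algebra.
From mathcomp Require Import all_classical all_reals all_analysis.
From mathcomp Require Import measurable_realfun.
From mathcomp Require Import ring lra zify.
From mathcomp Require polyrcf.

(** Sufficiency.  An inequality that is linear in homomorphism densities and
    holds for all symmetric matrices [W (x_i, x_j)] with [x] in [[0, 1]^n] can
    be integrated over [x]: an injective map [V(H) -> n] contributes exactly
    [t(H, W)] and the other maps are a fraction O(1/n) of all maps.  So
    graphons may be replaced by [n x n] matrices.

    For a matrix [A], put the distribution proportional to the weight on the
    homomorphisms of C_m; its vertex marginals all agree, and so do its edge
    marginals.  Gluing copies conditionally independently along a simple
    C_m-tree [H] with [a] vertex gluings, [b] edge gluings and [k = 1 + a + b]
    cycles gives a distribution on homomorphisms of [H] with computable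
    entropy, whence [t(H, A) >= t(C_m, A)^k / t(K_2, A)^b].  Linearising at
    [p] leaves [t(C_m, A) + t(C_m, J - A) >= q^m + (1 - q)^m] with
    [q = t(K_2, A)].  The derivative of [s |-> tr (A - s J)^m] is
    [- m 1^T (A - s J)^(m-1) 1], which Jensen's inequality for the even
    exponent [m - 1] bounds; integrating over [0 <= s <= 1] concludes.

    Necessity.  For [W = p + e r(x) r(y)] with [r = 1] on one half of [0, 1]
    and [r = -1] on the other, [t(H, W) = p^e(H) + k p^(e(H)-m) e^m + O(e^(m+1))].
    As [m] is odd, the terms of order [m] must cancel between the colours. *)

Set Implicit Arguments.
Unset Strict Implicit.
Unset Printing Implicit Defensive.

Import Order.TTheory GRing.Theory Num.Theory.

Local Open Scope ring_scope.

(** * Weights of vertex maps and identifications *)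

(** Swapping components exchanges the adjacent pairs that increase in the enumeration with those
    that decrease, and irreflexivity excludes equal components. *)
Lemma big_edges_sym (R : Type) (idx : R) (op : Monoid.com_law idx)
    (H : sgraph) (F : H -> H -> R) :
  (forall u v, F u v = F v u) ->
  \big[op/idx]_(p : H * H | adj p.1 p.2) F p.1 p.2 =
  op (\big[op/idx]_(p in edges H) F p.1 p.2)
     (\big[op/idx]_(p in edges H) F p.1 p.2).
Proof.
move=> Fsym; rewrite (bigID (fun p : H * H => enum_rank p.1 < enum_rank p.2)%N)/=.
congr (op _ _).
rewrite (reindex_inj (h := fun p : H * H => (p.2, p.1))) /=; last first.
  by move=> [a b] [c d] [-> ->].
apply: eq_big => [[u v]|[u v] _] /=; last exact: Fsym.
rewrite inE /= [LHS]andbC adj_sym -leqNgt andbC leq_eqVlt.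
case uv: (adj u v) => //=; case: eqP => // /val_inj/enum_rank_inj E.
by move: uv; rewrite E adj_irrefl.
Qed.

Lemma card_adj (H : sgraph) :
  #|[pred p : H * H | adj p.1 p.2]| = (2 * num_edges H)%N.
Proof.
rewrite -sum1_card (@big_edges_sym _ _ _ _ (fun _ _ => 1%N))//=.
by rewrite sum1_card mul2n addnn.
Qed.

Definition hom_weight (R : realType) (I : Type) (A : I -> I -> R) (H : sgraph)
    (f : H -> I) : R :=
  \prod_(uv in edges H) A (f uv.1) (f uv.2).

Section hom_weight.
Variables (R : realType) (I : Type) (A : I -> I -> R).
Hypothesis A_sym : forall x y, A x y = A y x.

(* Ordered adjacent pairs, which see every edge twice, do not depend on the
   enumeration of the vertices; weights of different graphs are therefore
   compared through their squares. *)
Lemma sqr_hom_weight (H : sgraph) (f : H -> I) :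
  hom_weight A f ^+ 2 = \prod_(p : H * H | adj p.1 p.2) A (f p.1) (f p.2).
Proof.
by rewrite (@big_edges_sym _ _ _ _ (fun u v => A (f u) (f v)))//= expr2.
Qed.

Lemma hom_weight_ge0 (H : sgraph) (f : H -> I) :
  (forall x y, 0 <= A x y) -> 0 <= hom_weight A f.
Proof. by move=> A0; apply: prodr_ge0. Qed.

Lemma eq_hom_weight (H : sgraph) (f g : H -> I) :
  f =1 g -> hom_weight A f = hom_weight A g.
Proof. by move=> fg; apply: eq_bigr => uv _; rewrite !fg. Qed.

End hom_weight.

Section identification.
Variables (H' C H : sgraph) (s : seq (disjoint_union H' C * disjoint_union H' C)).
Local Notation D := (disjoint_union H' C).
Variable q : D -> H.
Hypothesis q_surj : forall a, exists x, q x = a.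
Hypothesis q_eq :
  forall x y, q x = q y <-> [\/ x = y, (x, y) \in s | (y, x) \in s].
Hypothesis q_adj :
  forall a b, adj a b <-> exists x y, [/\ q x = a, q y = b & adj x y].

Definition copair (I : Type) (f : H' -> I) (g : C -> I) (x : D) : I :=
  match x with inl u => f u | inr i => g i end.

Definition agree (I : eqType) (f : H' -> I) (g : C -> I) : bool :=
  all (fun xy => copair f g xy.1 == copair f g xy.2) s.

(** A map on the quotient is the same thing as a pair of maps that agree on the identified vertices;
    the inverse correspondence uses a section [sec] of [q]. *)
Lemma big_identification (I : finType) (R : nmodType)
    (F : {ffun H' -> I} -> {ffun C -> I} -> R) :
  \sum_(f : {ffun H -> I})
     F [ffun u => f (q (inl u))] [ffun i => f (q (inr i))] =
  \sum_(fg : {ffun H' -> I} * {ffun C -> I} | agree fg.1 fg.2) F fg.1 fg.2.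
Proof.
have /choice[sec secK] := q_surj.
pose back (fg : {ffun H' -> I} * {ffun C -> I}) : {ffun H -> I} :=
  [ffun a => copair fg.1 fg.2 (sec a)].
pose fwd (f : {ffun H -> I}) : {ffun H' -> I} * {ffun C -> I} :=
  ([ffun u => f (q (inl u))], [ffun i => f (q (inr i))]).
have fwdE f x : copair (fwd f).1 (fwd f).2 x = f (q x).
  by case: x => x; rewrite /= ffunE.
have agree_back (fg : {ffun H' -> I} * {ffun C -> I}) x :
    agree fg.1 fg.2 -> back fg (q x) = copair fg.1 fg.2 x.
  move=> /allP ag; rewrite ffunE.
  by have /q_eq[->//|/ag/eqP//|/ag/eqP//] : q (sec (q x)) = q x by exact: secK.
rewrite (reindex_onto back fwd) /=; last first.
  by move=> f _; apply/ffunP => a; rewrite ffunE fwdE secK.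
have fwdK fg : (fwd (back fg) == fg) = agree fg.1 fg.2.
  apply/eqP/idP => [<-|ag].
    apply/allP => -[x y] xy; rewrite !fwdE; apply/eqP; congr (back fg _).
    by apply/q_eq; apply: Or32.
  case: fg ag => f g ag; congr (_, _); apply/ffunP => x; rewrite ffunE.
    exact: (agree_back (f, g) (inl x) ag).
  exact: (agree_back (f, g) (inr x) ag).
apply: eq_big => [fg|[f g]]; first exact: fwdK.
rewrite fwdK => ag; congr (F _ _); apply/ffunP => x; rewrite ffunE.
  exact: (agree_back (f, g) (inl x) ag).
exact: (agree_back (f, g) (inr x) ag).
Qed.

Lemma big_disjoint_union_adj (R : Type) (idx : R) (op : Monoid.com_law idx)
    (F : D -> D -> R) :
  \big[op/idx]_(p : D * D | adj p.1 p.2) F p.1 p.2 =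
  op (\big[op/idx]_(p : H' * H' | adj p.1 p.2) F (inl p.1) (inl p.2))
     (\big[op/idx]_(p : C * C | adj p.1 p.2) F (inr p.1) (inr p.2)).
Proof.
rewrite -(pair_big_dep xpredT (fun x y : D => adj x y) F) /= big_sumType /=.
rewrite -(pair_big_dep xpredT (fun x y : H' => adj x y)
  (fun x y => F (inl x) (inl y))).
rewrite -(pair_big_dep xpredT (fun x y : C => adj x y)
  (fun x y => F (inr x) (inr y))) /=.
congr (op _ _); apply: eq_bigr => x _; rewrite big_sumType /=.
  by rewrite [X in op _ X]big_pred0_eq Monoid.mulm1.
by rewrite [X in op X _]big_pred0_eq Monoid.mul1m.
Qed.

(* [ex] discards one of any two adjacent pairs of [D] that [q] merges. *)
Lemma big_identification_adj (R : Type) (idx : R) (op : Monoid.com_law idx)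
    (ex : pred (D * D)) (F : H -> H -> R) :
  (forall x y, adj x y -> exists x' y',
     [/\ q x' = q x, q y' = q y, adj x' y' & ~~ ex (x', y')]) ->
  (forall x y x' y', adj x y -> adj x' y' -> ~~ ex (x, y) -> ~~ ex (x', y') ->
     q x = q x' -> q y = q y' -> (x, y) = (x', y')) ->
  \big[op/idx]_(p : H * H | adj p.1 p.2) F p.1 p.2 =
  \big[op/idx]_(p : D * D | adj p.1 p.2 && ~~ ex p) F (q p.1) (q p.2).
Proof.
move=> q_rep q_inj.
(* [sec] lifts each adjacent pair of [H] to the adjacent pair of [D] above it that [ex] keeps; on
   other pairs its value is arbitrary. *)
have /choice[sec secP] (p : H * H) : exists x : D * D, adj p.1 p.2 ->
    [/\ q x.1 = p.1, q x.2 = p.2, adj x.1 x.2 & ~~ ex x].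
  have [pa|] := boolP (adj p.1 p.2); last first.
    case: p => a b _; have [x _] := q_surj a.
    by exists (x, x).
  move/q_adj : (pa) => [x [y [xa yb xy]]].
  have [x' [y' [xx' yy' xy' nex]]] := q_rep _ _ xy.
  by exists (x', y') => _; split; rewrite //= -?xa -?yb.
rewrite (reindex_onto (fun p : D * D => (q p.1, q p.2)) sec) /=; last first.
  by move=> [a b] /secP[/= -> ->].
apply: eq_bigl => -[x y] /=; apply/andP/andP => [[qa /eqP]|[xy nex]].
  have [/= _ _ + +] := secP (q x, q y) qa.
  by move=> + + E; rewrite E.
have qa : adj (q x) (q y) by apply/q_adj; exists x, y.
split=> //; apply/eqP; have [/=] := secP (q x, q y) qa.
by case: (sec _) => x' y' /= Ex Ey xy' nex'; apply: q_inj.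
Qed.

End identification.

Section gluing.
Variables (H' C H : sgraph).
Local Notation D := (disjoint_union H' C).

(* [al f = be g] says that [f] and [g] agree on the identified part, and [ell]
   is the weight of the edges that occur both in [H'] and in [C]. *)
Definition gluing (R : realType) (I S : finType) (A : I -> I -> R)
    (al : {ffun H' -> I} -> S) (be : {ffun C -> I} -> S) (ell : S -> R) : Prop :=
  exists qL : H' -> H, exists qR : C -> H,
  [/\ forall a, (exists u, qL u = a) \/ (exists i, qR i = a),
      forall a b, adj a b ->
        (exists u v, [/\ qL u = a, qL v = b & adj u v]) \/
        (exists i j, [/\ qR i = a, qR j = b & adj i j]),
      forall F : {ffun H' -> I} -> {ffun C -> I} -> R,
        \sum_(f : {ffun H -> I}) F [ffun u => f (qL u)] [ffun i => f (qR i)] =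
        \sum_(fg | al fg.1 == be fg.2) F fg.1 fg.2
    & forall f : {ffun H -> I},
        hom_weight A f * ell (al [ffun u => f (qL u)]) =
        hom_weight A [ffun u => f (qL u)] * hom_weight A [ffun i => f (qR i)]].

Lemma identification_cover (s : seq (D * D)) (q : D -> H) :
  (forall a, exists x, q x = a) ->
  (forall x y, q x = q y <-> [\/ x = y, (x, y) \in s | (y, x) \in s]) ->
  (forall a b, adj a b <-> exists x y, [/\ q x = a, q y = b & adj x y]) ->
  (forall a, (exists u, q (inl u) = a) \/ (exists i, q (inr i) = a)) /\
  (forall a b, adj a b ->
        (exists u v, [/\ q (inl u) = a, q (inl v) = b & adj u v]) \/
        (exists i j, [/\ q (inr i) = a, q (inr j) = b & adj i j])).
Proof.
move=> q_surj q_eq q_adj; split=> [a|a b /q_adj].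
  by have [[x|x] <-] := q_surj a; [left|right]; exists x.
by move=> [[x|x] [[y|y] [<- <- //= xy]]]; [left|right]; exists x, y.
Qed.

Section vertex.
Variables (u : H') (i : C).
Local Notation s := [:: (inl u, inr i) : D * D].
Variable q : D -> H.
Hypothesis q_surj : forall a, exists x, q x = a.
Hypothesis q_eq :
  forall x y, q x = q y <-> [\/ x = y, (x, y) \in s | (y, x) \in s].
Hypothesis q_adj :
  forall a b, adj a b <-> exists x y, [/\ q x = a, q y = b & adj x y].

Let q_eqE x y : q x = q y ->
  [\/ x = y, x = inl u /\ y = inr i | y = inl u /\ x = inr i].
Proof.
by move=> /q_eq[->|/[1!inE]/eqP[-> ->]|/[1!inE]/eqP[-> ->]];
  [apply: Or31|apply: Or32|apply: Or33].
Qed.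

(** Identifying a single vertex never merges two edges, as neither graph has loops; hence nothing is
    discarded and [ex] is [pred0]. *)
Let big_vertex (T : Type) (idx : T) (op : Monoid.com_law idx) (F : H -> H -> T) :
  \big[op/idx]_(p : H * H | adj p.1 p.2) F p.1 p.2 =
  op (\big[op/idx]_(p : H' * H' | adj p.1 p.2) F (q (inl p.1)) (q (inl p.2)))
     (\big[op/idx]_(p : C * C | adj p.1 p.2) F (q (inr p.1)) (q (inr p.2))).
Proof.
rewrite (big_identification_adj q_surj q_adj _ (ex := pred0)) /=.
- rewrite -(big_disjoint_union_adj _ (fun x y => F (q x) (q y))).
  by apply: eq_bigl => p; rewrite andbT.
- by move=> x y xy; exists x, y; split.
have uu := @adj_irrefl _ u; have ii := @adj_irrefl _ i; rewrite /is_true.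
move=> [x|x] [y|y] [x'|x'] [y'|y'] //= xy xy' _ _ /q_eqE Ex /q_eqE Ey;
  by case: Ex => [|[]|[]]; case: Ey => [|[]|[]]; congruence.
Qed.

Lemma vertex_identification_edges :
  num_edges H = (num_edges H' + num_edges C)%N.
Proof.
apply/eqP; rewrite -(eqn_pmul2l (isT : 0 < 2)%N) mulnDr -!card_adj -!sum1_card.
by apply/eqP; exact: (big_vertex _ (fun _ _ => 1%N)).
Qed.

(** The quotient map is injective away from [inr i] and remains surjective there, since [inr i] has
    the same image as [inl u]. *)
Lemma vertex_identification_vertices :
  (num_vertices H + 1 = num_vertices H' + num_vertices C)%N.
Proof.
have : {in predC1 (inr i : D) &, injective q}.
  by move=> x y /[!inE] /eqP xi /eqP yi /q_eqE[//|[_ //]|[_ //]].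
move=> /card_in_imset E; rewrite /num_vertices -card_sum.
rewrite [RHS](cardD1 (inr i)) inE addnC; congr (_ + _)%N.
rewrite -[LHS]cardsT; transitivity #|predC1 (inr i : D)|; last first.
  by apply: eq_card => x; rewrite !inE andbT.
rewrite -E; apply: eq_card => a; rewrite !inE; symmetry; apply/imsetP.
have [x <-] := q_surj a.
have [->|xi] := eqVneq x (inr i).
  by exists (inl u); [rewrite inE|apply/q_eq; apply: Or33; rewrite inE].
by exists x; rewrite ?inE.
Qed.

Lemma vertex_identification_gluing (R : realType) (I : finType)
    (A : I -> I -> R) :
  (forall x y, A x y = A y x) -> (forall x y, 0 <= A x y) ->
  gluing A (fun f : {ffun H' -> I} => f u) (fun g : {ffun C -> I} => g i)
    (fun=> 1).
Proof.
move=> A_sym A0; exists (q \o inl), (q \o inr).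
have [? ?] := identification_cover q_surj q_eq q_adj; split=> // [F|f].
  rewrite /= (big_identification q_surj q_eq).
  by apply: eq_bigl => -[f g]; rewrite /agree /= andbT.
apply/eqP; rewrite mulr1 -(eqrXn2 (n := 2))// ?mulr_ge0 ?hom_weight_ge0//.
rewrite exprMn !sqr_hom_weight// (big_vertex _ (fun a b => A (f a) (f b))) /=.
by apply/eqP; congr (_ * _); apply: eq_bigr => p _; rewrite !ffunE.
Qed.

End vertex.

Section edge.
Variables (u v : H') (i j : C).
Hypotheses (uv : adj u v) (ij : adj i j).
Local Notation s := [:: (inl u, inr i); (inl v, inr j) : D * D].
Variable q : D -> H.
Hypothesis q_surj : forall a, exists x, q x = a.
Hypothesis q_eq :
  forall x y, q x = q y <-> [\/ x = y, (x, y) \in s | (y, x) \in s].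
Hypothesis q_adj :
  forall a b, adj a b <-> exists x y, [/\ q x = a, q y = b & adj x y].

Let iDj : i <> j. Proof. by move=> E; move: ij; rewrite E adj_irrefl. Qed.

Let q_eqE x y : q x = q y ->
  x = y \/ ([\/ x = inl u /\ y = inr i, y = inl u /\ x = inr i,
                 x = inl v /\ y = inr j | y = inl v /\ x = inr j]).
Proof.
move=> /q_eq[->|/[!inE]/orP[]/eqP[-> ->]|/[!inE]/orP[]/eqP[-> ->]]; first by left.
- by right; apply: Or41.
- by right; apply: Or43.
- by right; apply: Or42.
- by right; apply: Or44.
Qed.

Let qui : q (inl u) = q (inr i).
Proof. by apply/q_eq; apply: Or32; rewrite !inE eqxx. Qed.
Let qvj : q (inl v) = q (inr j).
Proof. by apply/q_eq; apply: Or32; rewrite !inE eqxx orbT. Qed.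

Let ex : pred (D * D) := pred2 (inr i, inr j) (inr j, inr i).

(** The edge of [C] between [i] and [j] merges with the edge of [H'] between [u] and [v], so [ex]
    discards its two orientations; the extra factor on the left restores them. *)
Let big_edge (T : Type) (idx : T) (op : Monoid.com_law idx) (F : H -> H -> T) :
  op (op (F (q (inl u)) (q (inl v))) (F (q (inl v)) (q (inl u))))
    (\big[op/idx]_(p : H * H | adj p.1 p.2) F p.1 p.2) =
  op (\big[op/idx]_(p : H' * H' | adj p.1 p.2) F (q (inl p.1)) (q (inl p.2)))
     (\big[op/idx]_(p : C * C | adj p.1 p.2) F (q (inr p.1)) (q (inr p.2))).
Proof.
rewrite (big_identification_adj q_surj q_adj _ (ex := ex)) /=.
- rewrite -(big_disjoint_union_adj _ (fun x y => F (q x) (q y))).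
  rewrite [RHS](bigID ex) /=; congr (op _ _).
  have ijji : (inr i, inr j) != (inr j, inr i) :> D * D by apply/eqP => -[].
  rewrite (bigD1 (inr i, inr j)) /=; last by rewrite /= ij /ex /= eqxx.
  rewrite (bigD1 (inr j, inr i)) /=; last first.
    by rewrite /= adj_sym ij /ex /= eqxx orbT eq_sym.
  rewrite big_pred0 ?Monoid.mulm1 -?qui -?qvj//.
  move=> p; rewrite /ex /=; case: (p == (inr i, inr j)); case: (p == (inr j, inr i));
    by rewrite ?andbF.
- move=> x y xy; have [/orP[]/eqP[Ex Ey]|] := boolP (ex (x, y)).
  + by exists (inl u), (inl v); rewrite Ex Ey.
  + by exists (inl v), (inl u); rewrite Ex Ey; split; rewrite //= adj_sym.
  + by exists x, y.
have uu := @adj_irrefl _ u; have ii := @adj_irrefl _ i.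
have vv := @adj_irrefl _ v; have jj := @adj_irrefl _ j.
have exP p : ~~ ex p -> p <> (inr i, inr j) /\ p <> (inr j, inr i).
  by rewrite negb_or => /andP[/eqP ? /eqP].
move=> x y x' y' xy xy' /exP[n1 n2] /exP[n3 n4] /q_eqE Ex /q_eqE Ey.
move: xy xy' n1 n2 n3 n4 Ex Ey; rewrite /is_true.
move: x y x' y' => [x|x] [y|y] [x'|x'] [y'|y'] //= xy xy' n1 n2 n3 n4;
  by case=> [?|[][? ?]]; case=> [?|[][? ?]]; congruence.
Qed.

Lemma edge_identification_edges :
  (num_edges H + 1 = num_edges H' + num_edges C)%N.
Proof.
apply/eqP; rewrite -(eqn_pmul2l (isT : 0 < 2)%N) !mulnDr -!card_adj -!sum1_card.
by rewrite addnC; apply/eqP; exact: (big_edge _ (fun _ _ => 1%N)).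
Qed.

Lemma edge_identification_vertices :
  (num_vertices H + 2 = num_vertices H' + num_vertices C)%N.
Proof.
pose P := [predD1 predC1 (inr i : D) & inr j].
have : {in P &, injective q}.
  move=> x y; rewrite !inE => /andP[xj xi] /andP[yj yi] /q_eqE[//|].
  by case=> -[Ex Ey]; move: xj xi yj yi; rewrite Ex Ey !eqxx.
move=> /card_in_imset E; rewrite /num_vertices -card_sum.
rewrite [RHS](cardD1 (inr i)) inE (cardD1 (inr j)) !inE andbT.
have -> /= : (inr j != inr i :> D) by apply/eqP => -[] /esym.
rewrite addnA addnC; congr (_ + _)%N.
rewrite -[LHS]cardsT; transitivity #|P|; last first.
  by apply: eq_card => x; rewrite !inE andbT.
rewrite -E; apply: eq_card => a; rewrite !inE; symmetry; apply/imsetP.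
have [x <-] := q_surj a.
have [->|xi] := eqVneq x (inr i); first by exists (inl u).
have [->|xj] := eqVneq x (inr j); first by exists (inl v).
by exists x; rewrite ?inE ?xi ?xj.
Qed.

Lemma edge_identification_gluing (R : realType) (I : finType)
    (A : I -> I -> R) :
  (forall x y, A x y = A y x) -> (forall x y, 0 <= A x y) ->
  gluing A (fun f : {ffun H' -> I} => (f u, f v))
    (fun g : {ffun C -> I} => (g i, g j)) (fun xy => A xy.1 xy.2).
Proof.
move=> A_sym A0; exists (q \o inl), (q \o inr).
have [? ?] := identification_cover q_surj q_eq q_adj; split=> // [F|f].
  rewrite /= (big_identification q_surj q_eq).
  by apply: eq_bigl => -[f g]; rewrite /agree /= andbT.
apply/eqP; rewrite -(eqrXn2 (n := 2))// ?mulr_ge0 ?hom_weight_ge0//.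
rewrite !exprMn !sqr_hom_weight// /= !ffunE /=.
(* By symmetry of [A], the two orientations of the shared edge in [big_edge] supply exactly the
   square of [ell]. *)
have : A (f (q (inl u))) (f (q (inl v))) * A (f (q (inl v))) (f (q (inl u))) *
    \prod_(p : H * H | adj p.1 p.2) A (f p.1) (f p.2) = _ :=
  big_edge _ (fun a b => A (f a) (f b)).
rewrite (A_sym (f (q (inl v)))) -expr2 mulrC => -> /=.
by apply/eqP; congr (_ * _); apply: eq_bigr => p _; rewrite !ffunE.
Qed.

End edge.
End gluing.

(** * Walks and cycles *)

Section cycle.
Variable m : nat.
Hypothesis m_ge3 : (3 <= m)%N.
Local Notation C := (cycle_graph m).

Lemma ordS_neq (i : 'I_m) : ordS i != i.
Proof.
apply/eqP => /(congr1 val) /=; have := ltn_ord i.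
case: (ltnP i.+1 m) => [/modn_small -> _|mi im]; first lia.
have -> : i.+1 = m by lia.
by rewrite modnn; lia.
Qed.

(** For [m = 2] this fails; from [3 <= m] on, the two neighbours of a vertex of the cycle are
    distinct, so that no adjacent pair is counted twice in [big_cycle_adj]. *)
Lemma ordSS_neq (i : 'I_m) : ordS (ordS i) != i.
Proof.
apply/eqP => /(congr1 val) /=; have := ltn_ord i.
case: (ltnP i.+1 m) => [im _|mi im].
  rewrite (modn_small im).
  case: (ltnP i.+2 m) => [/modn_small ->|mi]; first lia.
  have E : i.+2 = m by lia.
  by rewrite E modnn; lia.
have -> : i.+1 = m by lia.
by rewrite modnn modn_small; lia.
Qed.

Lemma big_cycle_adj (T : Type) (idx : T) (op : Monoid.com_law idx)
    (F : 'I_m -> 'I_m -> T) :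
  \big[op/idx]_(p : C * C | adj p.1 p.2) F p.1 p.2 =
  op (\big[op/idx]_(i < m) F i (ordS i)) (\big[op/idx]_(i < m) F (ordS i) i).
Proof.
rewrite -(pair_big_dep xpredT (fun i j : C => adj i j) F) /=.
rewrite [X in op _ X](reindex_inj (@ord_pred_inj m)) /=.
rewrite -big_split; apply: eq_bigr => i _ /=.
have adjE (j k : 'I_m) :
    cycle_adj j k = (j != k) && ((k == ordS j) || (j == ordS k)) by [].
rewrite (bigD1 (ordS i)) /=; last by rewrite adjE eq_sym ordS_neq eqxx.
rewrite (bigD1 (ord_pred i)) /=; last first.
  rewrite adjE ord_predK eqxx orbT andbT -{1}(ord_predK i) ordS_neq /=.
  by rewrite -{2}(ord_predK i) eq_sym ordSS_neq.
rewrite ord_predK big_pred0 ?Monoid.mulm1// => j.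
rewrite adjE; apply/negP => /andP[/andP[/andP[_]]].
by move=> /orP[/eqP ->|/eqP ->]; rewrite ?ordSK eqxx.
Qed.

Lemma cycle_edges : num_edges C = m.
Proof.
apply/eqP; rewrite -(eqn_pmul2l (isT : 0 < 2)%N) -card_adj -sum1_card.
by rewrite (big_cycle_adj _ (fun _ _ => 1%N)) /= !sum1_card card_ord mul2n addnn.
Qed.

Lemma hom_weight_cycle (R : realType) (I : Type) (A : I -> I -> R) (f : C -> I) :
  (forall x y, A x y = A y x) -> (forall x y, 0 <= A x y) ->
  hom_weight A f = \prod_(i < m) A (f i) (f (ordS i)).
Proof.
move=> A_sym A0; apply/eqP; rewrite -(eqrXn2 (n := 2)) ?hom_weight_ge0//; last first.
  exact: prodr_ge0.
rewrite sqr_hom_weight// (big_cycle_adj _ (fun i j => A (f i) (f j))) /= expr2.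
by apply/eqP; congr (_ * _); apply: eq_bigr => i _.
Qed.

End cycle.

Section walks.
Variables (R : realType) (n : nat) (A : 'M[R]_n).

Fixpoint walk_weight (x : 'I_n) (s : seq 'I_n) : R :=
  if s is y :: s' then A x y * walk_weight y s' else 1.

Lemma big_tuple_cons (T : Type) (idx : T) (op : Monoid.com_law idx)
    (I : finType) k (F : k.+1.-tuple I -> T) :
  \big[op/idx]_(t : k.+1.-tuple I) F t =
  \big[op/idx]_(x : I) \big[op/idx]_(t : k.-tuple I) F [tuple of x :: t].
Proof.
rewrite pair_big /=.
rewrite (reindex (fun p : I * k.-tuple I => [tuple of p.1 :: p.2])) //.
exists (fun t : k.+1.-tuple I => (thead t, [tuple of behead t])) => [[x t] _|t _] /=.
  by congr (_, _); apply: val_inj.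
by rewrite -tuple_eta.
Qed.

(** The function [F] of the endpoint is what later closes the walk: taking an entry of [A] for it
    leads back to the root. *)
Lemma sum_walk_weight k x (F : 'I_n -> R) :
  \sum_(t : k.-tuple 'I_n) walk_weight x t * F (last x t) =
  \sum_y (A ^+ k) x y * F y.
Proof.
elim: k x => [|k IHk] x.
  rewrite (big_pred1 [tuple]) => [|t]; last by symmetry; apply/eqP; rewrite [t]tuple0.
  rewrite /= expr0 mul1r (bigD1 x)//= mxE eqxx mul1r big1 ?addr0// => y.
  by rewrite mxE eq_sym => /negbTE ->; rewrite mul0r.
rewrite big_tuple_cons /=.
under eq_bigr do under eq_bigr do rewrite -mulrA.
under eq_bigr do rewrite -mulr_sumr IHk mulr_sumr.
rewrite exchange_big /=; apply: eq_bigr => z _.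
by rewrite exprS mxE mulr_suml; apply: eq_bigr => y _; rewrite mulrA.
Qed.

(** Repeating the first vertex at the end unrolls the cyclic product into a closed walk. *)
Lemma prod_cycle_tuple k (t : k.+1.-tuple 'I_n) :
  \prod_(i < k.+1) A (tnth t i) (tnth t (ordS i)) =
  walk_weight (thead t) (rcons (behead t) (thead t)).
Proof.
have wE x s : walk_weight x s =
    \prod_(i < size s) A (nth x (x :: s) i) (nth x s i).
  elim: s x => [|y s IHs] x; first by rewrite big_ord0.
  rewrite /= big_ord_recl /= IHs; congr (_ * _); apply: eq_bigr => i _ /=.
  by congr (A _ _); apply: set_nth_default => //=; rewrite ltnS ltnW.
rewrite wE size_rcons size_behead size_tuple; apply: eq_bigr => i _.
case/tupleP: t => x t; rewrite [thead _]tnth0 /=.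
rewrite !(tnth_nth x) /= -rcons_cons nth_rcons /= size_tuple ltn_ord.
congr (A _ _); rewrite nth_rcons size_tuple.
have [ik|ki|->] := ltngtP; first by rewrite modn_small//= ltnS.
  by move: (ltn_ord i); rewrite ltnS leqNgt ki.
by rewrite modnn.
Qed.

(** Rotating the cycle moves the prescribed edge to index 0. After unrolling, the step from [x] to
    [y] gives [A x y], and the other [m - 1] steps lead from [y] back to [x]. *)
Lemma sum_rooted_cycle m (i : 'I_m) x y : (3 <= m)%N ->
  \sum_(f : {ffun 'I_m -> 'I_n} | (f i == x) && (f (ordS i) == y))
    \prod_(j < m) A (f j) (f (ordS j)) =
  A x y * (A ^+ m.-1) y x.
Proof.
move=> m_ge3.
pose weight (f : {ffun 'I_m -> 'I_n}) := \prod_(i < m) A (f i) (f (ordS i)).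
pose S j := \sum_(f : {ffun 'I_m -> 'I_n} | (f j == x) && (f (ordS j) == y)) weight f.
have rot j : S (ordS j) = S j.
  pose h (f : {ffun 'I_m -> 'I_n}) : {ffun 'I_m -> 'I_n} := [ffun i => f (ord_pred i)].
  rewrite /S (reindex_inj (h := h)); last first.
    by move=> f g /ffunP fg; apply/ffunP => l; have := fg (ordS l); rewrite !ffunE ordSK.
  apply: eq_big => [f|f _]; first by rewrite !ffunE !ordSK.
  rewrite /weight (reindex_inj (@ordS_inj m)); apply: eq_bigr => l _.
  by rewrite !ffunE !ordSK.
have m0 : (0 < m)%N by exact: leq_trans m_ge3.
have Si : S i = S (Ordinal m0).
  suff [j ->] : exists k, i = iter k (@ordS m) (Ordinal m0).
    by elim: j => //= j <-; exact: rot.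
  exists i; apply: val_inj => /=; move: (nat_of_ord i) (ltn_ord i) => k.
  by elim: k => //= k IHk km; rewrite -IHk ?(ltnW km)// modn_small.
rewrite -/(S i) {}Si {rot}/S /weight {weight}; case: m {i} m_ge3 m0 => [|[|k]]// _ m0.
rewrite (reindex (fun t : k.+2.-tuple 'I_n => [ffun i => tnth t i])) /=; last first.
  exists (fun f : {ffun 'I_k.+2 -> 'I_n} => [tuple f i | i < k.+2]) => [t _|f _].
    by apply: eq_from_tnth => i; rewrite tnth_mktuple ffunE.
  by apply/ffunP => i; rewrite ffunE tnth_mktuple.
have t0 z (t : k.+1.-tuple 'I_n) : tnth [tuple of z :: t] (Ordinal m0) = z.
  by rewrite (tnth_nth z).
have t1 z w (t : k.-tuple 'I_n) :
    tnth [tuple of z :: [tuple of w :: t]] (ordS (Ordinal m0)) = w.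
  by rewrite (tnth_nth z).
rewrite big_mkcond /= big_tuple_cons /= (bigD1 x)//= [X in _ + X]big1 ?addr0; last first.
  by move=> z zx; apply: big1 => t _; rewrite !ffunE t0 (negbTE zx).
rewrite big_tuple_cons /= (bigD1 y)//= [X in _ + X]big1 ?addr0; last first.
  by move=> z zx; apply: big1 => t _; rewrite !ffunE t1 (negbTE zx) andbF.
rewrite exprSr mxE -sum_walk_weight mulr_sumr; apply: eq_bigr => t _.
rewrite !ffunE t0 t1 !eqxx /=.
under eq_bigr do rewrite !ffunE.
rewrite prod_cycle_tuple [thead _]tnth0 /=; congr (_ * _).
elim: (tval t) y => [|z s IHs] y /=; first by rewrite mulr1 mul1r.
by rewrite IHs mulrA.
Qed.

End walks.

Lemma exp_mx_sym (R : realType) n (A : 'M[R]_n) k :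
  (forall x y, A x y = A y x) -> forall x y, (A ^+ k) x y = (A ^+ k) y x.
Proof.
move=> A_sym; suff E : (A ^+ k)^T = A ^+ k.
  by move=> x y; rewrite -[in LHS]E mxE.
elim: k => [|k IHk]; first by rewrite expr0 [LHS]trmx1.
rewrite {1}exprSr [LHS]trmx_mul IHk exprS; congr (_ *m _).
by apply/matrixP => x y; rewrite mxE.
Qed.

Section rooted_cycle_graph.
Variables (R : realType) (n m : nat) (A : 'M[R]_n).
Hypotheses (m_ge3 : (3 <= m)%N).
Hypotheses (A_sym : forall x y, A x y = A y x) (A0 : forall x y, 0 <= A x y).
Local Notation C := (cycle_graph m).

Lemma sum_edge_rooted_cycle (i j : C) x y : adj i j ->
  \sum_(f : {ffun C -> 'I_n} | (f i == x) && (f j == y)) hom_weight A f =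
  A x y * (A ^+ m.-1) x y.
Proof.
move=> /andP[_ ij].
under eq_bigr do rewrite hom_weight_cycle//.
case/orP: ij => /eqP ->.
  by rewrite sum_rooted_cycle// exp_mx_sym.
by under eq_bigl do rewrite andbC; rewrite sum_rooted_cycle// A_sym.
Qed.

Lemma sum_vertex_rooted_cycle (i : C) x :
  \sum_(f : {ffun C -> 'I_n} | f i == x) hom_weight A f = (A ^+ m) x x.
Proof.
have -> : A ^+ m = A * A ^+ m.-1 by rewrite -exprS prednK//; apply: leq_trans m_ge3.
rewrite mxE.
rewrite (partition_big (fun f : {ffun C -> 'I_n} => f (ordS i)) xpredT)//=.
apply: eq_bigr => y _; under eq_bigr do rewrite hom_weight_cycle//.
exact: sum_rooted_cycle.
Qed.

Lemma sum_cycle : \sum_(f : {ffun C -> 'I_n}) hom_weight A f = \tr (A ^+ m).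
Proof.
have m0 : (0 < m)%N by exact: leq_trans m_ge3.
rewrite (partition_big (fun f : {ffun C -> 'I_n} => f (Ordinal m0)) xpredT)//=.
by apply: eq_bigr => x _; exact: sum_vertex_rooted_cycle.
Qed.

End rooted_cycle_graph.

(** * The trace inequality for a matrix and its complement *)

Section trace_inequality.
Variables (R : realType) (n : nat).
Hypothesis n_gt0 : (0 < n)%N.
Implicit Types M A : 'M[R]_n.

Definition entry_sum M : R := \sum_x \sum_y M x y.

Let n0 : 0 < n%:R :> R. Proof. by rewrite ltr0n. Qed.

(** Cauchy-Schwarz: expand the sum of the squares of [V * u x - P * v x] and divide by [V]. *)
Lemma sqr_sum_mul_le (I : finType) (u v : I -> R) : 0 < \sum_x v x ^+ 2 ->
  (\sum_x u x * v x) ^+ 2 <= (\sum_x v x ^+ 2) * \sum_x u x ^+ 2.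
Proof.
set V := \sum_x v x ^+ 2; set P := \sum_x u x * v x; set U := \sum_x u x ^+ 2.
move=> V0; have : 0 <= \sum_x (V * u x - P * v x) ^+ 2.
  by apply: sumr_ge0 => x _; exact: sqr_ge0.
have -> : \sum_x (V * u x - P * v x) ^+ 2 = V * (V * U - P ^+ 2).
  transitivity (\sum_x (V ^+ 2 * u x ^+ 2 - 2 * V * P * (u x * v x) +
    P ^+ 2 * v x ^+ 2)); first by apply: eq_bigr => x _; ring.
  by rewrite !big_split/= sumrN -!mulr_sumr -/U -/V -/P; ring.
by rewrite pmulr_rge0// subr_ge0.
Qed.

(* The even moments of the spectral measure of [M] at the all-ones vector are
   log-convex, which gives Jensen's inequality for even powers. *)
Lemma entry_sum_even M l : (forall x y, M x y = M y x) ->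
  n%:R * (entry_sum M / n%:R) ^+ l.*2 <= entry_sum (M ^+ l.*2).
Proof.
move=> M_sym; pose v l x := \sum_y (M ^+ l) x y.
have vE i j : entry_sum (M ^+ (i + j)) = \sum_z v i z * v j z.
  rewrite /entry_sum exprD.
  under eq_bigr do under eq_bigr do rewrite mxE.
  under eq_bigr do rewrite exchange_big /=.
  rewrite exchange_big /=; apply: eq_bigr => z _.
  rewrite /v mulr_suml; apply: eq_bigr => x _.
  by rewrite mulr_sumr; apply: eq_bigr => y _; rewrite (exp_mx_sym _ M_sym x z).
have vS i : entry_sum (M ^+ i.*2) = \sum_z v i z ^+ 2.
  by rewrite -addnn vE; apply: eq_bigr => z _; rewrite expr2.
have w0 : entry_sum (M ^+ 0) = n%:R.
  rewrite -[0%N]/(0.*2) vS; under eq_bigr => z _.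
    rewrite /v expr0 (bigD1 z)//= mxE eqxx big1 ?addr0; last first.
      by move=> y yz; rewrite mxE eq_sym (negbTE yz).
    by rewrite expr1n over.
  by rewrite sumr_const card_ord.
rewrite -{1}mul2n exprM.
set r := (entry_sum M / n%:R) ^+ 2.
have [r0|r0] := eqVneq r 0.
  rewrite r0 vS; case: l => [|l]; first by rewrite expr0 mulr1 -vS w0.
  by rewrite expr0n /= mulr0; apply: sumr_ge0 => x _; exact: sqr_ge0.
have {}r0 : 0 < r by rewrite lt_neqAle eq_sym r0 sqr_ge0.
(* The first conjunct says that consecutive even moments grow at least by the factor [r]; the second
   keeps them positive, which allows cancelling one in the induction step. *)
suff [_ //] : r * entry_sum (M ^+ l.*2) <= entry_sum (M ^+ l.+1.*2) /\
    n%:R * r ^+ l <= entry_sum (M ^+ l.*2).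
elim: l => [|l [IH1 IH2]].
  split; last by rewrite w0 expr0 mulr1.
  have := @sqr_sum_mul_le _ (v 1%N) (v 0%N); rewrite -vE -!vS double0 w0 => /(_ n0).
  rewrite addn0 expr1 /r expr_div_n => le1.
  rewrite [leLHS](_ : _ = entry_sum M ^+ 2 / n%:R); last first.
    by field; rewrite lt0r_neq0.
  by rewrite ler_pdivrMr// mulrC.
have w_gt0 : 0 < entry_sum (M ^+ l.*2).
  by apply: lt_le_trans IH2; apply: mulr_gt0 => //; exact: exprn_gt0.
split; last first.
  by apply: le_trans IH1; rewrite exprS mulrCA ler_pM2l.
(* Log-convexity: the square of the moment of order [2l + 2] is at most the product of those of
   orders [2l] and [2l + 4], so the growth factor does not decrease. *)
have := @sqr_sum_mul_le _ (v l.+2) (v l).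
rewrite -vE -!vS => /(_ w_gt0).
have -> : (l.+2 + l = l.+1.*2)%N by lia.
move=> CS; rewrite -(ler_pM2l w_gt0); apply: le_trans CS.
rewrite mulrCA mulrA expr2 ler_wpM2r// vS.
by apply: sumr_ge0 => x _; exact: sqr_ge0.
Qed.

Lemma deriv_mulmx (M N : 'M[{poly R}]_n) :
  map_mx (@deriv R) (M * N) = map_mx (@deriv R) M * N + M * map_mx (@deriv R) N.
Proof.
apply/matrixP => x y; rewrite !mxE raddf_sum /= -big_split.
by apply: eq_bigr => z _; rewrite /= derivM !mxE.
Qed.

(** A matrix need not commute with its derivative, but under the trace the [k + 1] Leibniz terms
    agree by cyclicity. The proof carries a spare factor [M ^+ j] to absorb the rotated powers. *)
Lemma deriv_trace_exp (M : 'M[{poly R}]_n) k :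
  (\tr (M ^+ k.+1))^`() = \tr (map_mx (@deriv R) M * M ^+ k) *+ k.+1.
Proof.
have trD (N : 'M[{poly R}]_n) : (\tr N)^`() = \tr (map_mx (@deriv R) N).
  by rewrite /mxtrace raddf_sum; apply: eq_bigr => x _; rewrite mxE.
rewrite trD; suff E j : \tr (map_mx (@deriv R) (M ^+ k.+1) * M ^+ j) =
    \tr (map_mx (@deriv R) M * M ^+ (k + j)) *+ k.+1.
  by have := E 0%N; rewrite expr0 mulr1 addn0.
elim: k j => [|k IHk] j; first by rewrite expr1.
rewrite exprS deriv_mulmx mulrDl mxtraceD -mulrA -exprD mulrS; congr (_ + _).
by rewrite -mulrA [LHS]mxtrace_mulC -[in LHS]mulmxA -[_ *m M]exprSr IHk addSnnS.
Qed.

(** With [J] the all-ones matrix, the polynomial [Q], equal to [tr (A - s J)^m - (q - n s)^m] at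
    [s], has nonpositive derivative by [entry_sum_even]. As [m] is odd, [Q(1) <= Q(0)] is the
    claim. *)
Lemma trace_exp_complement A m :
  (forall x y, A x y = A y x) -> odd m ->
  (entry_sum A / n%:R) ^+ m + (n%:R - entry_sum A / n%:R) ^+ m <=
  \tr (A ^+ m) + \tr ((const_mx 1 - A) ^+ m).
Proof.
move=> A_sym; case: m => // l; rewrite [odd _]/= => l_even.
pose J : 'M[R]_n := const_mx 1; set q := entry_sum A / n%:R.
pose B s := A - s *: J.
pose Mp : 'M[{poly R}]_n := map_mx polyC A - 'X *: map_mx polyC J.
have MpE s : map_mx (horner_eval s) Mp = B s.
  by apply/matrixP => x y; rewrite !mxE /horner_eval !hornerE.
have MpX s k : map_mx (horner_eval s) (Mp ^+ k) = B s ^+ k.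
  elim: k => [|k IHk]; first by rewrite !expr0 [LHS]map_mx1.
  by rewrite !exprS [LHS]map_mxM MpE IHk.
have trE s (N : 'M[{poly R}]_n) : (\tr N).[s] = \tr (map_mx (horner_eval s) N).
  by rewrite -[LHS]/(horner_eval s _) -trace_map_mx.
have dMp : map_mx (@deriv R) Mp = - map_mx polyC J.
  apply/matrixP => x y; rewrite !mxE derivB derivC derivM derivX derivC.
  by rewrite mulr0 mul1r addr0 sub0r.
pose Q := \tr (Mp ^+ l.+1) - (q%:P - n%:R%:P * 'X) ^+ l.+1.
have B_sum s : entry_sum (B s) / n%:R = q - n%:R * s.
  rewrite /entry_sum; under eq_bigr do under eq_bigr do rewrite !mxE mulr1.
  under eq_bigr do rewrite big_split /= sumr_const card_ord.
  rewrite big_split /= sumr_const card_ord mulrDl -/(entry_sum A) -/q.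
  congr (_ + _); rewrite -(mulr_natr (- s *+ n)) -(mulr_natr (- s)) mulfK ?lt0r_neq0//.
  by rewrite mulNr mulrC.
have trJ N : \tr (- J * N) = - entry_sum N.
  rewrite mulNr raddfN /entry_sum exchange_big /=; congr (- _).
  by apply: eq_bigr => x _; rewrite mxE; apply: eq_bigr => y _; rewrite mxE mul1r.
have Q' s : Q^`().[s] <= 0.
  rewrite /Q derivB deriv_trace_exp dMp deriv_exp hornerD hornerN !hornerMn trE.
  have -> : map_mx (horner_eval s) (- map_mx polyC J * Mp ^+ l) = - J * B s ^+ l.
    rewrite [LHS]map_mxM MpX; congr (_ * _).
    by apply/matrixP => x y; rewrite !mxE [LHS]hornerN hornerC.
  rewrite trJ hornerM horner_exp derivB derivM derivX !derivC mul0r !add0r mulr1.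
  rewrite !hornerE -mulrnBl /= mulrn_wle0//.
  rewrite subr_le0 mulNr lerN2 -B_sum.
  have -> : l = l./2.*2 by rewrite -[LHS]odd_double_half (negbTE l_even).
  apply: entry_sum_even => x y; rewrite !mxE A_sym//.
(* The mean value theorem for polynomials takes the place of integrating the derivative over
   [[0, 1]]. *)
have [c _] := polyrcf.poly_mvt Q (ltr01 : 0 < 1 :> R).
rewrite subr0 mulr1 => Qc; have := Q' c; rewrite -Qc subr_le0.
rewrite /Q !hornerE !trE !MpX /= ?mulr0 ?subr0 ?mulr1.
have -> : B 0 = A by rewrite /B scale0r subr0.
have -> : B 1 = - (J - A) by rewrite /B scale1r opprB.
have oddN (S : pzRingType) (x : S) : (- x) ^+ l.+1 = - x ^+ l.+1.
  by rewrite exprNn -signr_odd /= l_even expr1 mulN1r.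
rewrite -[q - n%:R]opprB !oddN raddfN /=.
rewrite -/J; lra.
Qed.

End trace_inequality.

(** * Entropy of glued distributions *)

Lemma ln_le_subr1 (R : realType) (x : R) : 0 < x -> ln x <= x - 1.
Proof. by move=> x0; have := @le_ln1Dx R (x - 1); rewrite addrCA subrr addr0; apply; lra. Qed.

Section fiber_product.
Variables (R : realType) (X Y S : finType) (al : X -> S) (be : Y -> S).
Variables (mu : X -> R) (nu : Y -> R) (gam : S -> R).
Hypotheses (mu0 : forall x, 0 <= mu x) (nu0 : forall y, 0 <= nu y).
Hypothesis mu_gam : forall s, \sum_(x | al x == s) mu x = gam s.
Hypothesis nu_gam : forall s, \sum_(y | be y == s) nu y = gam s.

(** The law of a pair that is independent conditionally on the common value of [al] and [be]. Where
    [gam (al x)] is 0, so is [mu x], and the value 0 of the quotient is the right one. *)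
Definition fiber_density (x : X) (y : Y) : R := mu x * nu y / gam (al x).

Lemma fiber_gam_gt0 x : 0 < mu x -> 0 < gam (al x).
Proof.
move=> mux; rewrite -mu_gam (bigD1 x)//=.
by rewrite ltr_pwDl// sumr_ge0.
Qed.

Lemma fiber_gam_ge0 s : 0 <= gam s.
Proof. by rewrite -mu_gam sumr_ge0. Qed.

Lemma fiber_density_ge0 x y : 0 <= fiber_density x y.
Proof. by rewrite /fiber_density divr_ge0 ?mulr_ge0 ?fiber_gam_ge0. Qed.

Lemma fiber_density_gt0 x y : 0 < fiber_density x y -> 0 < mu x /\ 0 < nu y.
Proof.
rewrite /fiber_density !lt_def !mulf_eq0 !negb_or mu0 nu0.
by move=> /andP[/andP[/andP[-> ->] _] _].
Qed.

(** The first marginal is [mu]: summing [nu] over the fibre above [al x] gives [gam (al x)], which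
    cancels the denominator. *)
Lemma sum_fiberl (G : X -> R) :
  \sum_(p : X * Y | al p.1 == be p.2) G p.1 * fiber_density p.1 p.2 =
  \sum_x G x * mu x.
Proof.
rewrite -(pair_big_dep xpredT (fun x y => al x == be y)
  (fun x y => G x * fiber_density x y)) /=; apply: eq_bigr => x _.
rewrite -mulr_sumr; congr (_ * _).
under eq_bigl do rewrite eq_sym.
rewrite -mulr_suml -mulr_sumr nu_gam.
have := mu0 x; rewrite le_eqVlt => /predU1P[<-|mux]; first by rewrite !mul0r.
by rewrite mulfK// gt_eqF// fiber_gam_gt0.
Qed.

End fiber_product.

Section fiber_product_entropy.
Variables (R : realType) (X Y S : finType) (al : X -> S) (be : Y -> S).
Variables (mu : X -> R) (nu : Y -> R) (gam : S -> R).
Hypotheses (mu0 : forall x, 0 <= mu x) (nu0 : forall y, 0 <= nu y).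
Hypothesis mu_gam : forall s, \sum_(x | al x == s) mu x = gam s.
Hypothesis nu_gam : forall s, \sum_(y | be y == s) nu y = gam s.
Local Notation pi := (fiber_density al mu nu gam).

Lemma sum_fiberr (G : Y -> R) :
  \sum_(p : X * Y | al p.1 == be p.2) G p.2 * pi p.1 p.2 = \sum_y G y * nu y.
Proof.
rewrite -(sum_fiberl nu0 nu_gam mu_gam) (reindex (fun p : Y * X => (p.2, p.1))) /=.
  apply: eq_big => [p|p /eqP E]; first by rewrite eq_sym.
  by rewrite /fiber_density E (mulrC (mu _)).
by exists (fun p : X * Y => (p.2, p.1)) => -[].
Qed.

(** The Shannon entropy of [rho] plus the mean of [ln h], that is, minus the relative entropy of
    [rho] with respect to the weight [h]. Points of mass 0 contribute 0. *)
Definition entropy (Z : finType) (rho h : Z -> R) : R :=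
  \sum_z rho z * ln (h z / rho z).

(** Apply [ln u <= u - 1] at [u = h z / rho z / L] and average. The bound is sharpest when [L] is
    the sum of [h]; leaving [L] free makes it linear in that sum. *)
Lemma gibbs (Z : finType) (rho h : Z -> R) (L : R) :
  (forall z, 0 <= rho z) -> \sum_z rho z = 1 ->
  (forall z, 0 <= h z) -> (forall z, 0 < rho z -> 0 < h z) -> 0 < L ->
  entropy rho h <= ln L + (\sum_z h z) / L - 1.
Proof.
move=> rho0 rho1 h0 rhoh L0.
rewrite -[1]rho1 -[ln L]mulr1 -[X in _ * X]rho1 mulr_sumr mulr_suml -big_split -sumrB.
apply: ler_sum => z _ /=.
have := rho0 z; rewrite le_eqVlt => /predU1P[<-|rz].
  by rewrite mul0r mulr0 add0r subr0 divr_ge0// ltW.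
have hz := rhoh _ rz.
have := @ln_le_subr1 R (h z / rho z / L); rewrite !divr_gt0// => /(_ isT).
rewrite ln_div ?posrE ?divr_gt0// lerBlDr.
rewrite -(ler_pM2l rz) => /le_trans; apply.
rewrite le_eqVlt; apply/orP; left; apply/eqP; field.
by rewrite !gt_eqF.
Qed.

(** Chain rule: under conditional independence the entropies add up, less the entropy of the shared
    part, and [gibbs] bounds the latter by [ln L]. *)
Lemma entropy_fiber_product (h : X -> R) (k : Y -> R) (ell : S -> R) (L : R) :
  (forall x, 0 < mu x -> 0 < h x) -> (forall y, 0 < nu y -> 0 < k y) ->
  (forall s, 0 <= ell s) -> (forall s, 0 < gam s -> 0 < ell s) ->
  \sum_s gam s = 1 -> \sum_s ell s = L -> 0 < L ->
  entropy mu h + entropy nu k - ln L <=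
  \sum_(p : X * Y | al p.1 == be p.2)
     pi p.1 p.2 * ln (h p.1 * k p.2 / ell (al p.1) / pi p.1 p.2).
Proof.
move=> muh nuk ell0 gamell gam1 ellL L0.
have -> : \sum_(p : X * Y | al p.1 == be p.2)
     pi p.1 p.2 * ln (h p.1 * k p.2 / ell (al p.1) / pi p.1 p.2) =
   entropy mu h + entropy nu k - entropy gam ell.
  have -> : entropy mu h = \sum_x ln (h x / mu x) * mu x.
    by apply: eq_bigr => x _; rewrite mulrC.
  have -> : entropy nu k = \sum_x ln (k x / nu x) * nu x.
    by apply: eq_bigr => x _; rewrite mulrC.
  have -> : entropy gam ell = \sum_x ln (ell (al x) / gam (al x)) * mu x.
    rewrite [RHS](partition_big al xpredT)//=; apply: eq_bigr => s _.
    rewrite -{1}mu_gam mulr_suml; apply: eq_bigr => x /eqP <-.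
    by rewrite mulrC.
  rewrite -(sum_fiberl mu0 mu_gam nu_gam) -sum_fiberr.
  rewrite -(sum_fiberl mu0 mu_gam nu_gam (fun x => ln (ell (al x) / gam (al x)))).
  rewrite -big_split -sumrB; apply: eq_bigr => -[x y] /= _.
  have [pi0|pi0] := leP (pi x y) 0.
    have -> : pi x y = 0.
      by apply/eqP; rewrite eq_le pi0 (fiber_density_ge0 mu0 nu0 mu_gam).
    by rewrite mul0r !mulr0; ring.
  have [mux nuy] := fiber_density_gt0 mu0 nu0 pi0.
  have gx := fiber_gam_gt0 mu0 mu_gam mux; have lx := gamell _ gx.
  have hx := muh _ mux; have ky := nuk _ nuy.
  have -> : h x * k y / ell (al x) / pi x y =
      h x / mu x * (k y / nu y) / (ell (al x) / gam (al x)).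
    by rewrite /fiber_density; field; rewrite !gt_eqF.
  rewrite ln_div ?posrE ?mulr_gt0 ?divr_gt0// ?invr_gt0//.
  by rewrite lnM ?posrE ?divr_gt0//; ring.
rewrite lerD2l lerN2; have := gibbs (rho := gam) (h := ell) _ gam1 ell0 gamell L0.
rewrite ellL divff ?gt_eqF// addrK; apply => s.
by rewrite -mu_gam sumr_ge0.
Qed.

End fiber_product_entropy.

Section entropic.
Variables (R : realType) (n : nat) (A : 'M[R]_n).
Hypotheses (A_sym : forall x y, A x y = A y x) (A0 : forall x y, 0 <= A x y).

(** A single [f] serves all vertices and a single [g] all edges in both orientations, so any vertex
    or edge of one graph can be glued to any of another. *)
Definition has_marginals (H : sgraph) (mu : {ffun H -> 'I_n} -> R)
    (f : 'I_n -> R) (g : 'I_n -> 'I_n -> R) : Prop :=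
  (forall v x, \sum_(phi : {ffun H -> 'I_n} | phi v == x) mu phi = f x) /\
  (forall u v, adj u v -> forall x y,
    \sum_(phi : {ffun H -> 'I_n} | (phi u == x) && (phi v == y)) mu phi = g x y).

(** By [gibbs], such a [K] is a lower bound for the logarithm of the total weight of the maps from
    [H]. *)
Definition entropic (H : sgraph) f g (K : R) : Prop :=
  exists mu : {ffun H -> 'I_n} -> R,
  [/\ forall phi, 0 <= mu phi, \sum_phi mu phi = 1,
      forall phi, 0 < mu phi -> 0 < hom_weight A phi,
      has_marginals mu f g
    & K <= entropy mu (fun phi => hom_weight A phi)].

Lemma sum_pred_mulr (T : finType) (P : pred T) (F : T -> R) :
  \sum_(x | P x) F x = \sum_x (P x)%:R * F x.
Proof.
rewrite big_mkcond; apply: eq_bigr => x _.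
by case: (P x); rewrite ?mul1r ?mul0r.
Qed.

(** The witness is the conditionally independent coupling, read as a law on maps from [H]. Every
    vertex and edge of [H] comes from [H'] or [C], hence the marginals persist. *)
Lemma entropic_gluing (H' C H : sgraph) (S : finType) al be (ell gam : S -> R)
    f g (K1 K2 L : R) :
  gluing (H' := H') (C := C) H A al be ell ->
  (forall mu : {ffun H' -> 'I_n} -> R, has_marginals mu f g ->
     forall s, \sum_(phi | al phi == s) mu phi = gam s) ->
  (forall mu : {ffun C -> 'I_n} -> R, has_marginals mu f g ->
     forall s, \sum_(phi | be phi == s) mu phi = gam s) ->
  (forall s, 0 <= ell s) -> (forall s, 0 < gam s -> 0 < ell s) ->
  \sum_s gam s = 1 -> \sum_s ell s = L -> 0 < L ->
  entropic H' f g K1 -> entropic C f g K2 -> entropic H f g (K1 + K2 - ln L).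
Proof.
move=> [qL [qR [q_vert q_edge q_sum q_weight]]] al_gam be_gam ell0 gamell gam1 ellL L0.
move=> [mu [mu0 mu1 muh muM muK]] [nu [nu0 nu1 nuh nuM nuK]].
have mu_gam := al_gam _ muM; have nu_gam := be_gam _ nuM.
pose pi := fiber_density al mu nu gam.
pose rho (phi : {ffun H -> 'I_n}) :=
  pi [ffun u => phi (qL u)] [ffun i => phi (qR i)].
have pi0 := fiber_density_ge0 mu0 nu0 mu_gam.
have rho_suml (G : {ffun H' -> 'I_n} -> R) :
    \sum_(phi : {ffun H -> 'I_n}) G [ffun u => phi (qL u)] * rho phi = \sum_a G a * mu a.
  rewrite (q_sum (fun a b => G a * pi a b)).
  exact: (sum_fiberl mu0 mu_gam nu_gam).
have rho_sumr (G : {ffun C -> 'I_n} -> R) :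
    \sum_(phi : {ffun H -> 'I_n}) G [ffun u => phi (qR u)] * rho phi = \sum_a G a * nu a.
  rewrite (q_sum (fun a b => G b * pi a b)).
  exact: (sum_fiberr nu0 mu_gam nu_gam).
have rho_gt0 phi : 0 < rho phi ->
    0 < mu [ffun u => phi (qL u)] /\ 0 < nu [ffun i => phi (qR i)].
  exact: (fiber_density_gt0 (al := al) (gam := gam) mu0 nu0).
(* The weight [ell] of the shared edges may vanish off the support, so the division is made only
   where [rho] is positive. *)
have weightE (phi : {ffun H -> 'I_n}) : 0 < rho phi -> hom_weight A phi =
    hom_weight A [ffun u => phi (qL u)] * hom_weight A [ffun i => phi (qR i)] /
    ell (al [ffun u => phi (qL u)]).
  move=> rphi; have [mua nub] := rho_gt0 _ rphi.
  by rewrite -q_weight mulfK// gt_eqF// gamell// (fiber_gam_gt0 mu0 mu_gam).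
exists rho; split.
- by move=> phi; exact: pi0.
- rewrite -mu1; have := rho_suml (fun=> 1); rewrite -!mulr_sumr !mul1r; exact.
- move=> phi rphi; rewrite weightE//.
  have [mua nub] := rho_gt0 _ rphi.
  by rewrite divr_gt0 ?mulr_gt0 ?muh ?nuh// gamell// (fiber_gam_gt0 mu0 mu_gam).
- case: muM nuM => muV muE [nuV nuE]; split=> [w x|a b ab x y].
    case: (q_vert w) => -[u <-].
      rewrite -(muV u x) [LHS]sum_pred_mulr [RHS]sum_pred_mulr.
      rewrite -(rho_suml (fun phi => (phi u == x)%:R)).
      by apply: eq_bigr => phi _; rewrite ffunE.
    rewrite -(nuV u x) [LHS]sum_pred_mulr [RHS]sum_pred_mulr.
    rewrite -(rho_sumr (fun phi => (phi u == x)%:R)).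
    by apply: eq_bigr => phi _; rewrite ffunE.
  case: (q_edge _ _ ab) => -[u [v [<- <- uv]]].
    rewrite -(muE _ _ uv x y) [LHS]sum_pred_mulr [RHS]sum_pred_mulr.
    rewrite -(rho_suml (fun phi => ((phi u == x) && (phi v == y))%:R)).
    by apply: eq_bigr => phi _; rewrite !ffunE.
  rewrite -(nuE _ _ uv x y) [LHS]sum_pred_mulr [RHS]sum_pred_mulr.
  rewrite -(rho_sumr (fun phi => ((phi u == x) && (phi v == y))%:R)).
  by apply: eq_bigr => phi _; rewrite !ffunE.
apply: (@le_trans _ _ (entropy mu (fun phi => hom_weight A phi) +
  entropy nu (fun phi => hom_weight A phi) - ln L)).
  by rewrite lerD2r lerD.
apply: le_trans (entropy_fiber_product mu0 nu0 mu_gam nu_gam muh nuh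
  ell0 gamell gam1 ellL L0) _.
rewrite -(q_sum (fun a b => pi a b *
  ln (hom_weight A a * hom_weight A b / ell (al a) / pi a b))).
rewrite le_eqVlt; apply/orP; left; apply/eqP; apply: eq_bigr => phi _.
rewrite -/(rho phi); have [rphi|rphi] := leP (rho phi) 0; last by rewrite weightE.
have -> : rho phi = 0 by apply/eqP; rewrite eq_le rphi pi0.
by rewrite !mul0r.
Qed.

(* With [t] the sum on the right, [T] its value at density [p], and [X], [Y] the
   normalised traces, the bound is the sum of [ln u <= u - 1] for
   [u = t / (T X)], [b] times for [u = Y / X] and [a] times for [u = 1 / X]. *)
Lemma entropic_homsum (H : sgraph) f g (m a b : nat) (p : R) :
  (0 < n)%N -> 0 < p -> 0 < \tr (A ^+ m) -> 0 < entry_sum A ->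
  (num_edges H + b = m * (1 + a + b))%N ->
  (num_vertices H + a + 2 * b = m * (1 + a + b))%N ->
  entropic H f g (ln (\tr (A ^+ m)) *+ (1 + a + b) -
     ln n%:R *+ a - ln (entry_sum A) *+ b) ->
  n%:R ^+ num_vertices H * p ^+ num_edges H *
    ((1 + a + b)%:R * (\tr (A ^+ m) / (n%:R * p) ^+ m) -
     b%:R * (entry_sum A / (n%:R ^+ 2 * p)) - a%:R) <=
  \sum_(phi : {ffun H -> 'I_n}) hom_weight A phi.
Proof.
move=> n_gt0 p0 c0 q0 He Hv [mu [mu0 mu1 muh _ muK]].
have n0 : 0 < n%:R :> R by rewrite ltr0n.
set c := \tr _ in c0 muK *; set q := entry_sum A in q0 muK *.
set k := (1 + a + b)%N in He Hv muK *.
set t := \sum_phi _; set X := c / _; set Y := q / _.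
pose T := n%:R ^+ num_vertices H * p ^+ num_edges H.
have T0 : 0 < T by rewrite mulr_gt0 ?exprn_gt0.
have X0 : 0 < X by rewrite divr_gt0 ?exprn_gt0 ?mulr_gt0.
have Y0 : 0 < Y by rewrite divr_gt0 ?mulr_gt0 ?exprn_gt0.
have TX0 : 0 < T * X by rewrite mulr_gt0.
have := gibbs mu0 mu1 (fun phi => hom_weight_ge0 phi A0) muh TX0.
move=> /(le_trans muK); rewrite -/t.
have lnX : ln X = ln c - (ln n%:R + ln p) *+ m.
  by rewrite ln_div ?posrE ?exprn_gt0 ?mulr_gt0// lnXn ?mulr_gt0// lnM ?posrE.
have lnY : ln Y = ln q - (ln n%:R *+ 2 + ln p).
  by rewrite ln_div ?posrE ?mulr_gt0 ?exprn_gt0// lnM ?posrE ?exprn_gt0// lnXn.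
have lnT : ln T = ln n%:R *+ num_vertices H + ln p *+ num_edges H.
  by rewrite lnM ?posrE ?exprn_gt0// !lnXn.
rewrite lnM ?posrE// => main.
have leY : ln Y - ln X <= Y / X - 1.
  by rewrite -ln_div ?posrE// ln_le_subr1// divr_gt0.
have le1 : - ln X <= X^-1 - 1 by rewrite -lnV ?posrE// ln_le_subr1// invr_gt0.
(* The edge and vertex counts [He] and [Hv] make every [ln n] and [ln p] disappear into the
   normalised quantities [X] and [Y]. *)
have {}main : ln X *+ (a + b) - ln Y *+ b <= t / (T * X) - 1.
  have Hv' : (num_vertices H)%:R = m%:R * k%:R - a%:R - 2 * b%:R :> R.
    by have := congr1 (fun x : nat => x%:R : R) Hv; rewrite /k !natrD !natrM !natrD; lra.
  have He' : (num_edges H)%:R = m%:R * k%:R - b%:R :> R.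
    by have := congr1 (fun x : nat => x%:R : R) He; rewrite /k !natrD !natrM !natrD; lra.
  move: main; rewrite lnT.
  rewrite -[_ *+ k]mulr_natl -[_ *+ num_vertices H]mulr_natl.
  rewrite -[_ *+ num_edges H]mulr_natl Hv' He' -[ln n%:R *+ a]mulr_natl.
  rewrite -[ln q *+ b]mulr_natl -[_ *+ (a + b)]mulr_natl -[ln Y *+ b]mulr_natl.
  rewrite lnY lnX -[(ln n%:R + ln p) *+ m]mulr_natl -[ln n%:R *+ 2]mulr_natl.
  rewrite /k !natrD; move: (t / _) => z; lra.
have : k%:R - b%:R * (Y / X) - a%:R / X <= t / (T * X).
  have := ler_wpM2l (ler0n R b) leY; have := ler_wpM2l (ler0n R a) le1.
  move: main; rewrite -[_ *+ (a + b)]mulr_natl -[ln Y *+ b]mulr_natl /k !natrD.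
  move: (t / _) (Y / X) X^-1 => z w x; lra.
rewrite ler_pdivlMr// => le_t; apply: le_trans le_t.
rewrite le_eqVlt; apply/orP; left; apply/eqP; rewrite -/T; field.
by rewrite gt_eqF.
Qed.

End entropic.

(** * Perturbations by a rank-one sign matrix *)

Section graph_iso.
Variables (C H : sgraph) (f : C -> H).
Hypotheses (f_bij : bijective f) (f_adj : forall x y, adj (f x) (f y) = adj x y).

Lemma iso_vertices : num_vertices H = num_vertices C.
Proof. by rewrite /num_vertices (bij_eq_card f_bij). Qed.

Lemma big_iso_adj (T : Type) (idx : T) (op : Monoid.com_law idx) (F : H -> H -> T) :
  \big[op/idx]_(p : H * H | adj p.1 p.2) F p.1 p.2 =
  \big[op/idx]_(p : C * C | adj p.1 p.2) F (f p.1) (f p.2).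
Proof.
have [f' fK f'K] := f_bij.
rewrite (reindex (fun p : C * C => (f p.1, f p.2))) /=.
  by apply: eq_bigl => p; rewrite f_adj.
by exists (fun p : H * H => (f' p.1, f' p.2)) => -[a b] _ /=; rewrite ?fK ?f'K.
Qed.

Lemma iso_edges : num_edges H = num_edges C.
Proof.
apply/eqP; rewrite -(eqn_pmul2l (isT : 0 < 2)%N) -!card_adj -!sum1_card.
by apply/eqP; exact: (big_iso_adj _ (fun _ _ => 1%N)).
Qed.

Lemma hom_weight_iso (R : realType) (I : Type) (A : I -> I -> R) (phi : H -> I) :
  (forall x y, A x y = A y x) -> (forall x y, 0 <= A x y) ->
  hom_weight A phi = hom_weight A (phi \o f).
Proof.
move=> A_sym A0; apply/eqP; rewrite -(eqrXn2 (n := 2)) ?hom_weight_ge0//.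
by rewrite !sqr_hom_weight// (big_iso_adj _ (fun u v => A (phi u) (phi v))).
Qed.

Lemma sum_iso (I : finType) (R : nmodType) (F : {ffun C -> I} -> R) :
  \sum_(phi : {ffun H -> I}) F [ffun i => phi (f i)] = \sum_psi F psi.
Proof.
have [f' fK f'K] := f_bij.
rewrite [RHS](reindex (fun phi : {ffun H -> I} => [ffun i => phi (f i)])) //.
exists (fun psi : {ffun C -> I} => [ffun a => psi (f' a)]) => phi _;
  by apply/ffunP => a; rewrite !ffunE ?fK ?f'K.
Qed.

End graph_iso.

(** * The entropy of a weighted cycle *)

Section entropic_base.
Variables (R : realType) (n m : nat) (A : 'M[R]_n).
Hypotheses (m_ge3 : (3 <= m)%N).
Hypotheses (A_sym : forall x y, A x y = A y x) (A0 : forall x y, 0 <= A x y).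
Hypothesis c0 : 0 < \tr (A ^+ m).

(** The marginals of the law proportional to the weight: a diagonal entry weighs the closed walks at
    [x], and an edge is completed to a cycle by [m - 1] further steps. *)
Definition cycle_vertex_marginal (x : 'I_n) : R := (A ^+ m) x x / \tr (A ^+ m).
Definition cycle_edge_marginal (x y : 'I_n) : R :=
  A x y * (A ^+ m.-1) x y / \tr (A ^+ m).

Lemma sum_cycle_vertex_marginal : \sum_x cycle_vertex_marginal x = 1.
Proof. by rewrite -mulr_suml divff// gt_eqF. Qed.

Lemma sum_cycle_edge_marginal :
  \sum_(xy : 'I_n * 'I_n) cycle_edge_marginal xy.1 xy.2 = 1.
Proof.
rewrite -mulr_suml -(pair_bigA _ (fun x y => A x y * (A ^+ m.-1) x y)) /=.
rewrite [X in X / _](_ : _ = \tr (A ^+ m)) ?divff ?gt_eqF//.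
apply: eq_bigr => x _.
have -> : A ^+ m = A * A ^+ m.-1 by rewrite -exprS prednK//; apply: leq_trans m_ge3.
by rewrite mxE; apply: eq_bigr => y _; rewrite (exp_mx_sym _ A_sym x y).
Qed.

(** Under the law proportional to the weight, the ratio of weight to probability is the constant
    trace on the support, so the entropy bound is an equality. *)
Lemma entropic_cycle (H : sgraph) : graph_iso (cycle_graph m) H ->
  entropic A H cycle_vertex_marginal cycle_edge_marginal (ln (\tr (A ^+ m))).
Proof.
move=> [f f_bij f_adj]; have [f' fK f'K] := f_bij.
have c_gt0 := c0; set c := \tr (A ^+ m) in c_gt0 *.
have weightE (phi : {ffun H -> 'I_n}) :
    hom_weight A phi = hom_weight A [ffun i => phi (f i)].
  rewrite (hom_weight_iso f_bij f_adj _ A_sym A0).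
  by apply: eq_hom_weight => i; rewrite /= ffunE.
have sum1 : \sum_(phi : {ffun H -> 'I_n}) hom_weight A phi / c = 1.
  under eq_bigr do rewrite weightE.
  by rewrite (sum_iso f_bij (fun psi => hom_weight A psi / c)) -mulr_suml
    sum_cycle// divff// gt_eqF.
exists (fun phi => hom_weight A phi / c); split.
- by move=> phi; rewrite divr_ge0 ?hom_weight_ge0// ltW.
- by [].
- by move=> phi; rewrite pmulr_lgt0 ?invr_gt0.
- split=> [v x|u v uv x y].
    rewrite -mulr_suml /cycle_vertex_marginal -(sum_vertex_rooted_cycle m_ge3 A_sym A0 (f' v)).
    rewrite [X in X / _ = _]sum_pred_mulr [X in _ = X / _]sum_pred_mulr -(sum_iso f_bij).
    by under [in RHS]eq_bigr do rewrite ffunE f'K -weightE.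
  have uv' : adj (f' u) (f' v) by rewrite -f_adj !f'K.
  rewrite -mulr_suml /cycle_edge_marginal -(sum_edge_rooted_cycle m_ge3 A_sym A0 _ _ uv').
  rewrite [X in X / _ = _]sum_pred_mulr [X in _ = X / _]sum_pred_mulr -(sum_iso f_bij).
  by under [in RHS]eq_bigr do rewrite !ffunE !f'K -weightE.
rewrite -[leLHS]mulr1 -sum1 mulr_sumr /entropy le_eqVlt; apply/orP; left; apply/eqP.
apply: eq_bigr => phi _; rewrite mulrC.
have [->|h0] := eqVneq (hom_weight A phi) 0; first by rewrite !mul0r.
by congr (_ * ln _); field; rewrite h0 gt_eqF.
Qed.

End entropic_base.

(** * Powers and spin correlations of the sign matrix *)

Section sign_matrix.
Variable R : realType.
Implicit Types p e : R.

Definition spin (x : 'I_2) : R := (-1) ^+ x.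

Definition sign_mx p e : 'M[R]_2 := \matrix_(x, y) (p + e * (spin x * spin y)).

Lemma spin_sqr x : spin x * spin x = 1.
Proof. by rewrite /spin -expr2 sqrr_sign. Qed.

Lemma norm_spin x : `|spin x| = 1.
Proof. by rewrite /spin normrX normrN1 expr1n. Qed.

Lemma spin_rev x : spin (rev_ord x) = - spin x.
Proof. by case: x => -[|[|//]] i; rewrite /spin /= ?expr0 ?expr1 ?opprK. Qed.

Lemma sign_mx_sym p e x y : sign_mx p e x y = sign_mx p e y x.
Proof. by rewrite !mxE (mulrC (spin x)). Qed.

Lemma sign_mx_gt0 p e x y : `|e| < p -> 0 < sign_mx p e x y.
Proof.
move=> ep; rewrite mxE; have := ler_norm (- (e * (spin x * spin y))).
rewrite normrN !normrM !norm_spin !mulr1; lra.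
Qed.

(** The constant vector and [spin] are orthogonal eigenvectors, with eigenvalues [2 p] and [2 e]. *)
Lemma sign_mx_exp p e k x y :
  (sign_mx p e ^+ k.+1) x y = 2 ^+ k * (p ^+ k.+1 + e ^+ k.+1 * (spin x * spin y)).
Proof.
elim: k x y => [|k IHk] x y; first by rewrite expr1 mxE expr0 !expr1 mul1r.
rewrite exprS mxE big_ord_recl big_ord1 !IHk !mxE.
have -> : spin ord0 = 1 by [].
have -> : spin (lift ord0 ord0) = -1 by rewrite /spin expr1.
rewrite !exprS; ring.
Qed.

Section correlations.
Variable H : sgraph.
Local Notation cfg := {ffun H -> 'I_2}.

(** Reversing the spin at [w] is an involution of the configurations that negates every summand. *)
Lemma sum_spin_odd (w : H) (G : cfg -> R) :
  (forall a b : cfg, (forall z, z != w -> a z = b z) -> G a = G b) ->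
  \sum_(a : cfg) spin (a w) * G a = 0.
Proof.
move=> Gw; pose flip (a : cfg) : cfg := [ffun z => if z == w then rev_ord (a z) else a z].
have flipK : involutive flip.
  by move=> a; apply/ffunP => z; rewrite !ffunE; case: eqP => // _; rewrite rev_ordK.
set s := \sum_a _; suff : s = - s by move=> E; lra.
rewrite {1}/s (reindex_inj (inv_inj flipK)) /= /s -sumrN; apply: eq_bigr => a _.
rewrite ffunE eqxx spin_rev mulNr; congr (- (_ * _)); apply: Gw => z zw.
by rewrite ffunE (negbTE zw).
Qed.

Lemma sum_spin_edge (u v : H) : adj u v ->
  \sum_(a : cfg) spin (a u) * spin (a v) = 0.
Proof.
move=> uv; apply: sum_spin_odd => a b ab; rewrite ab//.
by apply/eqP => E; rewrite E adj_irrefl in uv.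
Qed.

(** Orthogonality of edge characters: two distinct edges leave some vertex on exactly one of them,
    whose spin sums to 0; for equal edges all spins are squared. *)
Lemma sum_spin_edges (u v x y : H) : adj u v -> adj x y ->
  \sum_(a : cfg) spin (a u) * spin (a v) * (spin (a x) * spin (a y)) =
  2 ^+ #|H| * ((x == u) && (y == v) || (x == v) && (y == u))%:R.
Proof.
move=> uv xy.
have uDv : u != v by apply/eqP => E; rewrite E adj_irrefl in uv.
have xDy : x != y by apply/eqP => E; rewrite E adj_irrefl in xy.
have [/orP[]/andP[/eqP -> /eqP ->]|] := boolP (_ || _).
- rewrite mulr1; under eq_bigr do rewrite mulrACA !spin_sqr mulr1.
  by rewrite sumr_const card_ffun card_ord -natrX.
- rewrite mulr1; under eq_bigr do rewrite (mulrC (spin (_ v))) mulrACA !spin_sqr mulr1.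
  by rewrite sumr_const card_ffun card_ord -natrX.
rewrite mulr0 => nxy.
(* If neither [x] nor [y] is [u], the unpaired vertex is [u]; otherwise it is [v]. *)
have [/andP[ux uy]|] := boolP ((x != u) && (y != u)).
  under eq_bigr do rewrite -mulrA.
  apply: sum_spin_odd => a b ab; rewrite !ab// eq_sym//.
rewrite negb_and !negbK => xyu.
under eq_bigr do rewrite (mulrC (spin (_ u))) -mulrA.
have [vx vy] : x != v /\ y != v.
  move: nxy xyu; rewrite negb_or !negb_and.
  case/orP: (orbN (x == u)) => [/eqP ->|xu].
    by rewrite eqxx /= uDv => /andP[-> _].
  rewrite (negbTE xu) /= => + /eqP E; rewrite E eqxx orbF eq_sym uDv.
  by rewrite eq_sym => ->.
by apply: sum_spin_odd => a b ab; rewrite !ab.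
Qed.

(** The coefficient of degree 1 is multiplied by [p] to avoid the truncated exponent
    [size s - 1]. *)
Lemma prod_linear_coef p (T : Type) (s : seq T) (w : T -> R) :
  let P := \prod_(i <- s) (p%:P + w i *: 'X) in
  P`_0 = p ^+ size s /\ p * P`_1 = p ^+ size s * \sum_(i <- s) w i.
Proof.
elim: s => [|i s [IH0 IH1]] /=.
  by rewrite !big_nil expr0 !coef1 /= mul1r mulr0.
rewrite !big_cons mulrDl -scalerAl coefD coefCM coefZ coefXM /= IH0 mulr0 addr0 -exprS.
split=> //; rewrite coefD coefCM coefZ coefXM /= IH0 mulrDr IH1 exprS; ring.
Qed.

(** Expand the weight in powers of [e]. The constant term is orthogonal to the character of [uv],
    and of the linear term only the edge [uv] itself survives. *)
Lemma sum_spin_hom_weight p (u v : H) : 0 < p -> adj u v ->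
  exists Q : {poly R}, forall e,
  \sum_(a : cfg) hom_weight (sign_mx p e) a * (spin (a u) * spin (a v)) =
  2 ^+ #|H| * (e * p ^+ (num_edges H).-1 + e ^+ 2 * Q.[e]).
Proof.
move=> p0 uv.
pose w (a : cfg) (xy : H * H) := spin (a xy.1) * spin (a xy.2).
pose P (a : cfg) : {poly R} := \prod_(xy in edges H) (p%:P + w a xy *: 'X).
have PE (a : cfg) e : hom_weight (sign_mx p e) a = (P a).[e].
  rewrite horner_prod; apply: eq_bigr => xy _.
  by rewrite mxE hornerD hornerC hornerZ hornerX mulrC.
pose S := \sum_(a : cfg) w a (u, v) *: P a.
have edges_gt0 : (0 < num_edges H)%N.
  rewrite -(ltn_pmul2l (isT : 0 < 2)%N) muln0 -card_adj.
  by apply/card_gt0P; exists (u, v); rewrite inE.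
have coefP a := prod_linear_coef p (enum (edges H)) (w a).
have PenumE a : P a = \prod_(xy <- enum (edges H)) (p%:P + w a xy *: 'X).
  by rewrite big_enum.
have size_enum : size (enum (edges H)) = num_edges H by rewrite -cardE.
have S0 : S`_0 = 0.
  rewrite coef_sum; under eq_bigr do rewrite coefZ PenumE (coefP _).1 size_enum.
  by rewrite -mulr_suml sum_spin_edge// mul0r.
have S1 : S`_1 = 2 ^+ #|H| * p ^+ (num_edges H).-1.
  apply: (mulfI (lt0r_neq0 p0)); rewrite mulrCA -exprS prednK//.
  rewrite coef_sum mulr_sumr.
  under eq_bigr do rewrite coefZ PenumE mulrCA (coefP _).2 size_enum mulrCA big_enum /=.
  rewrite -mulr_sumr mulrC; congr (_ * _).
  under eq_bigr do rewrite mulr_sumr.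
  rewrite exchange_big /=.
  (* Doubling passes from edges to ordered adjacent pairs, where exactly [(u, v)] and [(v, u)]
     contribute. *)
  apply: (@mulrI _ 2); first by rewrite unitfE pnatr_eq0.
  pose F (x y : H) := \sum_(a : cfg) w a (u, v) * (spin (a x) * spin (a y)).
  have Fsym x y : F x y = F y x.
    by apply: eq_bigr => a _; rewrite (mulrC (spin (a x))).
  have FE : \sum_(xy : H * H | adj xy.1 xy.2) F xy.1 xy.2 =
      \sum_(xy in edges H) F xy.1 xy.2 + \sum_(xy in edges H) F xy.1 xy.2.
    exact: (big_edges_sym _ Fsym).
  rewrite [LHS]mulr_natl mulr2n -[X in X + X]/(\sum_(xy in edges H) F xy.1 xy.2) -FE /F.
  rewrite (bigD1 (u, v))//= (bigD1 (v, u)) /=; last first.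
    by rewrite adj_sym uv; apply/eqP => -[_ E]; move: uv; rewrite E adj_irrefl.
  rewrite [X in _ + (_ + X)]big1 => [|[x y] /= /andP[/andP[xy xyuv] xyvu]].
    rewrite !sum_spin_edges// ?(adj_sym v)// !eqxx /= orbT addr0 !mulr1; ring.
  rewrite sum_spin_edges//; move: xyuv xyvu; rewrite !xpair_eqE.
  by move=> /negbTE -> /negbTE ->; rewrite mulr0.
exists ((2 ^+ #|H|)^-1 *: drop_poly 2 S) => e.
have two0 : 2 ^+ #|H| != 0 :> R by rewrite expf_neq0// pnatr_eq0.
transitivity S.[e].
  rewrite horner_sum; apply: eq_bigr => a _; rewrite hornerZ PE mulrC//.
rewrite -[in LHS](poly_take_drop 2 S) hornerD hornerM hornerXn hornerZ.
rewrite [take_poly _ _](_ : _ = S`_1 *: 'X); last first.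
  apply/polyP => -[|[|i]]; rewrite coef_take_poly coefZ coefX /= ?S0 ?mulr0 ?mulr1//.
rewrite hornerZ hornerX S1; field.
by rewrite ?two0.
Qed.

End correlations.

End sign_matrix.

(** * Induction along simple cycle trees *)

(** Summing over the maps on [C] first turns the glued copy into a factor that depends on [a] only
    through [al a]. *)
Lemma sum_gluing (R : realType) (H' C H : sgraph) (I S : finType)
    (A : I -> I -> R) al be (ell : S -> R) :
  gluing (H' := H') (C := C) H A al be ell -> (forall s, 0 < ell s) ->
  \sum_(phi : {ffun H -> I}) hom_weight A phi =
  \sum_(a : {ffun H' -> I}) hom_weight A a / ell (al a) *
     \sum_(b : {ffun C -> I} | be b == al a) hom_weight A b.
Proof.
move=> [qL [qR [_ _ q_sum q_weight]]] ell0.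
transitivity (\sum_(phi : {ffun H -> I})
  hom_weight A [ffun u => phi (qL u)] / ell (al [ffun u => phi (qL u)]) *
  hom_weight A [ffun i => phi (qR i)]).
  by apply: eq_bigr => phi _; rewrite mulrAC -q_weight mulfK// gt_eqF.
rewrite (q_sum (fun a b => hom_weight A a / ell (al a) * hom_weight A b)).
rewrite -(pair_big_dep xpredT (fun a b => al a == be b)
  (fun a b => hom_weight A a / ell (al a) * hom_weight A b)) /=.
apply: eq_bigr => a _; rewrite -mulr_sumr; congr (_ * _).
by apply: eq_bigl => b; rewrite eq_sym.
Qed.

Section cycle_tree.
Variables (R : realType) (m : nat).
Hypothesis m_ge3 : (3 <= m)%N.
Local Notation C := (cycle_graph m).

Let m_gt0 : (0 < m)%N. Proof. exact: leq_trans m_ge3. Qed.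

(** There are [2 ^+ #|H|] configurations, so the factor in parentheses is a homomorphism density;
    [k] will be the number of cycles of [H]. The range of [e] keeps the matrix entries positive. *)
Definition expands (H : sgraph) (k : nat) : Prop :=
  forall p : R, 0 < p -> exists Q : {poly R}, forall e, `|e| < p ->
  \sum_(phi : {ffun H -> 'I_2}) hom_weight (sign_mx p e) phi =
  2 ^+ #|H| * (p ^+ num_edges H + k%:R * p ^+ (num_edges H - m) * e ^+ m
    + e ^+ m.+1 * Q.[e]).

(** The trace is exactly [(2 p)^m + (2 e)^m], which leaves no remainder. *)
Lemma expands_cycle H : graph_iso C H -> expands H 1.
Proof.
move=> [f f_bij f_adj] p p0; exists 0 => e ep.
have A_sym := sign_mx_sym p e.
have A0 x y : 0 <= sign_mx p e x y by rewrite ltW// sign_mx_gt0.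
under eq_bigr => phi _.
  rewrite (hom_weight_iso f_bij f_adj _ A_sym A0).
  rewrite (eq_hom_weight _ (g := [ffun i => phi (f i)])); last first.
    by move=> i; rewrite /= ffunE.
  over.
rewrite (sum_iso f_bij (fun psi => hom_weight (sign_mx p e) psi)) sum_cycle//.
rewrite (iso_edges f_bij f_adj) -[#|H|]/(num_vertices H) (iso_vertices f_bij).
rewrite cycle_edges// /num_vertices card_ord subnn horner0.
have trE : \tr (sign_mx p e ^+ m) = 2 * 2 ^+ m.-1 * (p ^+ m + e ^+ m).
  rewrite /mxtrace big_ord_recl big_ord1 -[in LHS](prednK m_gt0) !sign_mx_exp.
  by rewrite !spin_sqr prednK//; ring.
by rewrite trE -exprS prednK// expr0; ring.
Qed.

Section gluing_step.
Variables (H' H : sgraph).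
Hypothesis mH' : (m <= num_edges H')%N.

(** The cycles rooted at a vertex weigh [2^(m-1) (p^m + e^m)] whatever the spin of the root, so the
    expansion of [H'] is multiplied by this constant. *)
Lemma expands_vertex (u : H') (i : C) k :
  num_edges H = (num_edges H' + m)%N -> (#|H| + 1 = #|H'| + m)%N ->
  (forall A : 'M[R]_2, (forall x y, A x y = A y x) -> (forall x y, 0 <= A x y) ->
     gluing H A (fun f : {ffun H' -> 'I_2} => f u)
       (fun g : {ffun C -> 'I_2} => g i) (fun=> 1)) ->
  expands H' k -> expands H k.+1.
Proof.
move=> EH VH glue exp p p0; have [Q QE] := exp p p0.
(* These are the terms of the product beyond order [m], divided by [e^(m+1)]; the middle one comes
   from [e^(2m)]. *)
exists ((p ^+ m) *: Q + (k%:R * p ^+ (num_edges H' - m)) *: 'X^(m.-1) + 'X^m * Q) => e ep.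
have A_sym := sign_mx_sym p e.
have A0 x y : 0 <= sign_mx p e x y by rewrite ltW// sign_mx_gt0.
rewrite (sum_gluing (glue _ A_sym A0))//.
under eq_bigr => a _.
  rewrite divr1 sum_vertex_rooted_cycle// -[in X in _ * X](prednK m_gt0) sign_mx_exp.
  rewrite spin_sqr mulr1 prednK//.
  over.
rewrite -mulr_suml QE// EH addnK.
have -> : #|H| = (#|H'| + m.-1)%N by lia.
have [d ->] : exists d, num_edges H' = (d + m)%N.
  by exists (num_edges H' - m)%N; rewrite subnK.
rewrite addnK !(hornerD, hornerZ, hornerM, hornerXn).
have em : e ^+ m = e * e ^+ m.-1 by rewrite -exprS prednK.
rewrite !exprD [e ^+ m.+1]exprS em -natr1; ring.
Qed.

(** After division by the shared edge, the rooted cycle weighs [2^(m-2)] times [p^(m-1)] plus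
    [e^(m-1)] times the two spins. The correlation of these spins is itself of order [e], and this
    supplies the new term in [e^m]. *)
Lemma expands_edge (u v : H') (i j : C) k : adj u v -> adj i j ->
  (num_edges H + 1 = num_edges H' + m)%N -> (#|H| + 2 = #|H'| + m)%N ->
  (forall A : 'M[R]_2, (forall x y, A x y = A y x) -> (forall x y, 0 <= A x y) ->
     gluing H A (fun f : {ffun H' -> 'I_2} => (f u, f v))
       (fun g : {ffun C -> 'I_2} => (g i, g j)) (fun xy => A xy.1 xy.2)) ->
  expands H' k -> expands H k.+1.
Proof.
move=> uv ij EH VH glue exp p p0; have [Q QE] := exp p p0.
have [Q' Q'E] := sum_spin_hom_weight p0 uv.
exists ((p ^+ m.-1) *: Q + Q') => e ep.
have A_sym := sign_mx_sym p e.
have Agt0 x y : 0 < sign_mx p e x y by exact: sign_mx_gt0.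
have A0 x y : 0 <= sign_mx p e x y by exact: ltW.
rewrite (sum_gluing (glue _ A_sym A0)) => [|xy]; last exact: Agt0.
have m2 : m.-1 = m.-2.+1 by lia.
transitivity (2 ^+ m.-2 * (p ^+ m.-1 *
    (\sum_(a : {ffun H' -> 'I_2}) hom_weight (sign_mx p e) a) +
    e ^+ m.-1 * \sum_(a : {ffun H' -> 'I_2})
      hom_weight (sign_mx p e) a * (spin R (a u) * spin R (a v)))).
  rewrite !mulr_sumr -big_split mulr_sumr; apply: eq_bigr => a _ /=.
  under eq_bigl do rewrite xpair_eqE.
  rewrite sum_edge_rooted_cycle// mulrA divfK ?gt_eqF//.
  by rewrite [in LHS]m2 sign_mx_exp -m2; ring.
rewrite QE// Q'E.
have -> : #|H| = (#|H'| + m.-2)%N by lia.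
have [d Ed] : exists d, num_edges H' = (d + m)%N.
  by exists (num_edges H' - m)%N; rewrite subnK.
have -> : num_edges H = (d + m + m.-1)%N by lia.
have -> : (d + m + m.-1 - m = d + m.-1)%N by lia.
rewrite Ed addnK (_ : (d + m).-1 = (d + m.-1)%N); last by lia.
rewrite hornerD hornerZ.
have em : e ^+ m = e * e ^+ m.-1 by rewrite -exprS prednK.
rewrite !exprD [e ^+ m.+1]exprS em -natr1; ring.
Qed.

End gluing_step.

(** Here [a] and [b] count the vertex and edge gluings. A single induction carries all four facts,
    since they must hold for the same [a] and [b]; the counts are stated additively to avoid
    truncated subtraction. *)
Lemma cycle_tree_facts (H : sgraph) : simple_cycle_tree m H ->
  exists a b,
  [/\ (num_edges H + b = m * (1 + a + b))%N,
      (num_vertices H + a + 2 * b = m * (1 + a + b))%N,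
      (forall n (A : 'M[R]_n), (0 < n)%N ->
        (forall x y, A x y = A y x) -> (forall x y, 0 <= A x y) ->
        0 < \tr (A ^+ m) -> 0 < entry_sum A ->
        entropic A H (cycle_vertex_marginal m A) (cycle_edge_marginal m A)
          (ln (\tr (A ^+ m)) *+ (1 + a + b) - ln n%:R *+ a - ln (entry_sum A) *+ b))
    & expands H (1 + a + b)].
Proof.
have iso_refl : graph_iso C C by exists id => //; exists id.
have vertC : num_vertices C = m by rewrite /num_vertices card_ord.
elim=> {H} [H iso|H' H u i _ [a [b [EH' VH' ent exp]]] idn|
            H' H u v i j _ [a [b [EH' VH' ent exp]]] uv ij idn].
- exists 0%N, 0%N; split; last exact: expands_cycle.
  + case: iso => f f_bij f_adj.
    by rewrite (iso_edges f_bij f_adj) cycle_edges// !addn0 muln1.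
  + by case: iso => f f_bij _; rewrite (iso_vertices f_bij) vertC !addn0 muln1.
  + move=> n A _ A_sym A0 c0 _; rewrite !mulr0n !subr0 mulr1n.
    exact: entropic_cycle.
- case: idn => q [q_surj q_eq q_adj].
  have EH := vertex_identification_edges q_surj q_eq q_adj.
  have VH := vertex_identification_vertices q_surj q_eq.
  rewrite cycle_edges// in EH; rewrite vertC in VH.
  have mH' : (m <= num_edges H')%N by nia.
  exists a.+1, b; split; [lia|lia| |].
  + move=> n A n0 A_sym A0 c0 q0.
    have -> : ln (\tr (A ^+ m)) *+ (1 + a.+1 + b) - ln n%:R *+ a.+1 -
        ln (entry_sum A) *+ b = ln (\tr (A ^+ m)) *+ (1 + a + b) - ln n%:R *+ a -
        ln (entry_sum A) *+ b + ln (\tr (A ^+ m)) - ln n%:R.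
      by rewrite addnS addSn !mulrS; ring.
    apply: (entropic_gluing (vertex_identification_gluing q_surj q_eq q_adj A_sym A0)
      (gam := cycle_vertex_marginal m A)) => //.
    * by move=> mu [muV _] s; exact: muV.
    * by move=> mu [muV _] s; exact: muV.
    * exact: sum_cycle_vertex_marginal.
    * by rewrite sumr_const card_ord.
    * by rewrite ltr0n.
    * exact: ent.
    * exact: entropic_cycle.
  + rewrite addnS addSn; apply: (expands_vertex mH' (u := u) (i := i)) => //.
    by move=> A; exact: vertex_identification_gluing.
- case: idn => q [q_surj q_eq q_adj].
  have EH := edge_identification_edges uv ij q_surj q_eq q_adj.
  have VH := edge_identification_vertices ij q_surj q_eq.
  rewrite cycle_edges// in EH; rewrite vertC in VH.
  have mH' : (m <= num_edges H')%N by nia.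
  exists a, b.+1; split; [lia|lia| |].
  + move=> n A n0 A_sym A0 c0 q0.
    have -> : ln (\tr (A ^+ m)) *+ (1 + a + b.+1) - ln n%:R *+ a -
        ln (entry_sum A) *+ b.+1 = ln (\tr (A ^+ m)) *+ (1 + a + b) - ln n%:R *+ a -
        ln (entry_sum A) *+ b + ln (\tr (A ^+ m)) - ln (entry_sum A).
      by rewrite addnS !mulrS; ring.
    apply: (entropic_gluing (edge_identification_gluing uv ij q_surj q_eq q_adj A_sym A0)
      (gam := fun xy => cycle_edge_marginal m A xy.1 xy.2)) => //.
    * move=> mu [_ muE] [x y] /=; rewrite -(muE _ _ uv).
      by apply: eq_bigl => phi; rewrite xpair_eqE.
    * move=> mu [_ muE] [x y] /=; rewrite -(muE _ _ ij).
      by apply: eq_bigl => phi; rewrite xpair_eqE.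
    * move=> [x y] /=; rewrite /cycle_edge_marginal !lt_def A0 andbT.
      by case/andP; rewrite !mulf_eq0 !negb_or => /andP[/andP[]].
    * exact: sum_cycle_edge_marginal.
    * by rewrite -(pair_bigA _ (fun x y => A x y)).
    * exact: ent.
    * exact: entropic_cycle.
  + rewrite addnS; apply: (expands_edge mH' uv ij) => //.
    by move=> A; exact: edge_identification_gluing.
Qed.

End cycle_tree.

(** * The inequality for matrices *)

(** The power function lies above its tangent at [p]: each gap is [x] times the preceding one plus a
    nonnegative multiple of [(x - p)^2]. *)
Lemma expr_tangent_le (R : realType) (x p : R) k : 0 <= x -> 0 <= p ->
  p ^+ k.+1 + k.+1%:R * p ^+ k * (x - p) <= x ^+ k.+1.
Proof.
move=> x0 p0; elim: k => [|k IHk]; first by rewrite !expr1 expr0; lra.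
rewrite -subr_ge0.
have -> : x ^+ k.+2 - (p ^+ k.+2 + k.+2%:R * p ^+ k.+1 * (x - p)) =
    x * (x ^+ k.+1 - (p ^+ k.+1 + k.+1%:R * p ^+ k * (x - p))) +
    k.+1%:R * p ^+ k * (x - p) ^+ 2.
  by rewrite !exprS -(natr1 k.+1); ring.
by rewrite addr_ge0// mulr_ge0 ?sqr_ge0 ?subr_ge0// mulr_ge0// exprn_ge0.
Qed.

Lemma cycle_tree_edges_ge (e m a b : nat) : (1 <= m)%N ->
  (e + b = m * (1 + a + b))%N -> (m <= e)%N.
Proof. by nia. Qed.

(** Identifies the numerator in the condition of the theorem, the cyclomatic number, with the number
    of glued cycles. *)
Lemma cycle_tree_euler (R : realType) (e v m a b : nat) :
  (e + b = m * (1 + a + b))%N -> (v + a + 2 * b = m * (1 + a + b))%N ->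
  e%:R - v%:R + 1 = (1 + a + b)%:R :> R.
Proof.
move=> EH VH; have : (e + 1 = v + (1 + a + b))%N by lia.
by move=> /(congr1 (fun k : nat => k%:R : R)); rewrite !natrD; lra.
Qed.

(** Regroups the linearised bound into [lam] times the gap between the cycle density and the tangent
    of the [m]-th power at [p], plus the deviation of the edge density with coefficient 1,
    independent of the graph. *)
Lemma tangent_termE (R : realType) (n m e k a b : nat) (p q c lam : R) :
  (0 < m)%N -> 0 < n%:R :> R -> 0 < p -> 0 < e%:R :> R ->
  (e + b = m * k)%N -> (k = 1 + a + b)%N ->
  k%:R / (e%:R * p ^+ m.-1) = lam ->
  p / e%:R * (k%:R * (c / (n%:R * p) ^+ m) - b%:R * (q / (n%:R ^+ 2 * p)) - a%:R) =
  p / e%:R + lam * (c / n%:R ^+ m - p ^+ m -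
     m%:R * p ^+ m.-1 * (q / n%:R ^+ 2 - p)) + (q / n%:R ^+ 2 - p).
Proof.
move=> m0 n0 p0 e0 eE kab lamE.
have -> : a%:R = k%:R - 1 - b%:R :> R by rewrite kab !natrD; ring.
have -> : b%:R = m%:R * k%:R - e%:R :> R by rewrite -natrM -eE natrD; ring.
rewrite -lamE exprMn [p ^+ m](_ : _ = p * p ^+ m.-1); last by rewrite -exprS prednK.
field.
by rewrite !gt_eqF ?exprn_gt0.
Qed.

Section finite_common.
Variables (R : realType) (m : nat).
Hypotheses (m_ge3 : (3 <= m)%N) (m_odd : odd m).

Lemma homsum_lower_bound (H : sgraph) a b n (A : 'M[R]_n) p :
  (0 < n)%N -> 0 < p ->
  (forall x y, A x y = A y x) -> (forall x y, 0 <= A x y) ->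
  (num_edges H + b = m * (1 + a + b))%N ->
  (num_vertices H + a + 2 * b = m * (1 + a + b))%N ->
  (0 < \tr (A ^+ m) -> 0 < entry_sum A ->
   entropic A H (cycle_vertex_marginal m A) (cycle_edge_marginal m A)
     (ln (\tr (A ^+ m)) *+ (1 + a + b) - ln n%:R *+ a - ln (entry_sum A) *+ b)) ->
  p / (num_edges H)%:R *
    ((1 + a + b)%:R * (\tr (A ^+ m) / (n%:R * p) ^+ m) -
     b%:R * (entry_sum A / (n%:R ^+ 2 * p)) - a%:R) <=
  (\sum_(phi : {ffun H -> 'I_n}) hom_weight A phi) / n%:R ^+ num_vertices H /
    ((num_edges H)%:R * p ^+ (num_edges H - 1)).
Proof.
move=> n_gt0 p0 A_sym A0 EH VH ent.
have n0 : 0 < n%:R :> R by rewrite ltr0n.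
have m_gt0 : (0 < m)%N by exact: leq_trans m_ge3.
have e_gt0 : (0 < num_edges H)%N := leq_trans m_gt0 (cycle_tree_edges_ge m_gt0 EH).
have e0 : 0 < (num_edges H)%:R :> R by rewrite ltr0n.
have q0 : 0 <= entry_sum A by apply: sumr_ge0 => x _; apply: sumr_ge0.
(* The entropy argument needs a positive trace; without it the lower bound is nonpositive while the
   right side is nonnegative. *)
have [c0|c0] := leP (\tr (A ^+ m)) 0.
  apply: (@le_trans _ _ 0).
    apply: mulr_ge0_le0; first by rewrite divr_ge0// ltW.
    rewrite subr_le0; apply: (@le_trans _ _ 0); last by rewrite ler0n.
    rewrite subr_le0; apply: (@le_trans _ _ 0).
      by rewrite mulr_ge0_le0// mulr_le0_ge0// invr_ge0 exprn_ge0// ltW ?mulr_gt0.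
    by rewrite mulr_ge0// divr_ge0// ltW// mulr_gt0// exprn_gt0.
  rewrite !divr_ge0 ?mulr_ge0 ?exprn_ge0 ?ler0n ?(ltW p0)// sumr_ge0// => phi _.
  exact: hom_weight_ge0.
have {}q0 : 0 < entry_sum A.
  rewrite lt_def q0 andbT; apply/eqP => qE; move: c0.
  have rowE x : \sum_y A x y = 0.
    by apply: (psumr_eq0P _ qE) => // z _; apply: sumr_ge0.
  have -> : A = 0.
    apply/matrixP => x y; rewrite mxE.
    by apply: (psumr_eq0P _ (rowE x)).
  by rewrite expr0n gtn_eqF ?(leq_trans _ m_ge3)// mxtrace0 ltxx.
have := entropic_homsum A0 n_gt0 p0 c0 q0 EH VH (ent c0 q0).
set S := \sum_phi _; set B := _ - a%:R.
have -> : p ^+ num_edges H = p * p ^+ (num_edges H - 1) by rewrite -exprS -addn1 subnK.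
move=> le_S.
rewrite -[leRHS]mulrA -invfM ler_pdivlMr ?mulr_gt0 ?exprn_gt0//.
apply: le_trans le_S; rewrite le_eqVlt; apply/orP; left; apply/eqP; field.
by rewrite gt_eqF.
Qed.

Lemma finite_common (H1 H2 : sgraph) (p1 p2 : R) n (A1 A2 : 'M[R]_n) :
  (0 < n)%N ->
  simple_cycle_tree m H1 -> simple_cycle_tree m H2 ->
  0 < p1 < 1 -> 0 < p2 < 1 -> p1 + p2 = 1 ->
  ((num_edges H1)%:R - (num_vertices H1)%:R + 1) /
    ((num_edges H1)%:R * p1 ^+ (m - 1)) =
  ((num_edges H2)%:R - (num_vertices H2)%:R + 1) /
    ((num_edges H2)%:R * p2 ^+ (m - 1)) ->
  (forall x y, A1 x y = A1 y x) ->
  (forall x y, 0 <= A1 x y) -> (forall x y, 0 <= A2 x y) ->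
  (forall x y, A1 x y + A2 x y = 1) ->
  p1 / (num_edges H1)%:R + p2 / (num_edges H2)%:R <=
  (\sum_(phi : {ffun H1 -> 'I_n}) hom_weight A1 phi) / n%:R ^+ num_vertices H1 /
    ((num_edges H1)%:R * p1 ^+ (num_edges H1 - 1)) +
  (\sum_(phi : {ffun H2 -> 'I_n}) hom_weight A2 phi) / n%:R ^+ num_vertices H2 /
    ((num_edges H2)%:R * p2 ^+ (num_edges H2 - 1)).
Proof.
move=> n_gt0 tree1 tree2 /andP[p1_gt0 _] /andP[p2_gt0 _] p12 cond A1_sym A1_0 A2_0 A12.
have [a1 [b1 [E1 V1 ent1 _]]] := cycle_tree_facts R m_ge3 tree1.
have [a2 [b2 [E2 V2 ent2 _]]] := cycle_tree_facts R m_ge3 tree2.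
have A2E : A2 = const_mx 1 - A1.
  by apply/matrixP => x y; rewrite !mxE -(A12 x y) addrC addKr.
have A2_sym x y : A2 x y = A2 y x by rewrite A2E !mxE A1_sym.
have n0 : 0 < n%:R :> R by rewrite ltr0n.
have := homsum_lower_bound n_gt0 p1_gt0 A1_sym A1_0 E1 V1 (ent1 _ _ n_gt0 A1_sym A1_0).
have := homsum_lower_bound n_gt0 p2_gt0 A2_sym A2_0 E2 V2 (ent2 _ _ n_gt0 A2_sym A2_0).
set S1 := _ / _ / _; set S2 := _ / _ / _ => leS1 leS2.
apply: le_trans (lerD leS2 leS1).
have := trace_exp_complement n_gt0 A1_sym m_odd; rewrite -A2E.
have q12 : entry_sum A1 + entry_sum A2 = n%:R ^+ 2.
  rewrite /entry_sum -big_split /=; under eq_bigr do rewrite -big_split /=.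
  under eq_bigr do under eq_bigr do rewrite A12.
  by rewrite !sumr_const card_ord -mulrnA natrM expr2.
set y := entry_sum A1 / n%:R ^+ 2.
have -> : entry_sum A1 / n%:R = n%:R * y by rewrite /y; field; rewrite gt_eqF.
have y_ge0 : 0 <= y.
  rewrite divr_ge0 ?exprn_ge0 ?ler0n// /entry_sum.
  by apply: sumr_ge0 => x _; apply: sumr_ge0.
have y2E : entry_sum A2 / n%:R ^+ 2 = 1 - y.
  have -> : entry_sum A2 = n%:R ^+ 2 - entry_sum A1 by rewrite -q12 addrC addKr.
  by rewrite /y; field; rewrite gt_eqF.
have y_le1 : 0 <= 1 - y.
  rewrite -y2E divr_ge0 ?exprn_ge0 ?ler0n// /entry_sum.
  by apply: sumr_ge0 => x _; apply: sumr_ge0.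
have -> : n%:R - n%:R * y = n%:R * (1 - y) by rewrite mulrBr mulr1.
have nm0 : 0 < n%:R ^+ m :> R by rewrite exprn_gt0.
rewrite [(n%:R * y) ^+ m]exprMn [(n%:R * (1 - y)) ^+ m]exprMn -mulrDr mulrC -ler_pdivlMr//.
have m1 : m = m.-1.+1 by rewrite prednK// (leq_trans _ m_ge3).
(* The edge densities of the two colours are [y] and [1 - y]; tangents at [p1] and [p2] bound their
   [m]-th powers from below. *)
have tan1 := expr_tangent_le m.-1 y_ge0 (ltW p1_gt0).
have tan2 := expr_tangent_le m.-1 y_le1 (ltW p2_gt0).
rewrite -m1 in tan1 tan2; move=> le_tr; have := le_trans (lerD tan1 tan2) le_tr.
set c1 := \tr (A1 ^+ m); set c2 := \tr (A2 ^+ m); rewrite [(c1 + c2) / _]mulrDl {le_tr}.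
have m_gt0 : (0 < m)%N by exact: leq_trans m_ge3.
have e1_gt0 : 0 < (num_edges H1)%:R :> R.
  by rewrite ltr0n (leq_trans m_gt0 (cycle_tree_edges_ge m_gt0 E1)).
have e2_gt0 : 0 < (num_edges H2)%:R :> R.
  by rewrite ltr0n (leq_trans m_gt0 (cycle_tree_edges_ge m_gt0 E2)).
move: cond; rewrite (cycle_tree_euler R E1 V1) (cycle_tree_euler R E2 V2) subn1.
set k1 := (1 + a1 + b1)%N in E1 *; set k2 := (1 + a2 + b2)%N in E2 *.
set e1 : R := (num_edges H1)%:R; set e2 : R := (num_edges H2)%:R.
set P1 := p1 ^+ m.-1; set P2 := p2 ^+ m.-1; set lam := _ / (e1 * _) => lamE.
rewrite (tangent_termE (k := k1) (lam := lam) _ _ m_gt0 n0 p1_gt0 e1_gt0 E1)//.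
rewrite (tangent_termE (k := k2) (lam := lam) _ _ m_gt0 n0 p2_gt0 e2_gt0 E2)//.
rewrite -/y y2E -/c1 -/c2 -/P1 -/P2 -/e1 -/e2.
have lam_gt0 : 0 < lam.
  by rewrite divr_gt0 ?mulr_gt0 ?exprn_gt0// ltr0n.
move: (p1 ^+ m) (p2 ^+ m) (c1 / _) (c2 / _) => pm1 pm2 C1 C2 tangent.
rewrite -subr_ge0.
(* The condition gives both colours the same [lam], and the deviations [y - p1] and [1 - y - p2]
   cancel; what remains is [lam] times a nonnegative gap. *)
have -> : forall u v : R, u + lam * (C1 - pm1 - m%:R * P1 * (y - p1)) + (y - p1) +
   (v + lam * (C2 - pm2 - m%:R * P2 * (1 - y - p2)) + (1 - y - p2)) - (u + v) =
   lam * (C1 + C2 - (pm1 + m%:R * P1 * (y - p1) + (pm2 + m%:R * P2 * (1 - y - p2)))).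
  by move=> u v; rewrite -p12; ring.
by rewrite mulr_ge0 ?(ltW lam_gt0)// subr_ge0.
Qed.

End finite_common.

(** * Boxes and coordinate selections *)

Section boxes.
Variable R : realType.
Local Open Scope classical_set_scope.
Local Notation leb n := (@lebesgue_tuple R n).

Definition box n (B : 'I_n -> set R) : set (n.-tuple R) :=
  [set t | forall i, B i (tnth t i)].

Lemma measurable_box n (B : 'I_n -> set R) :
  (forall i, measurable (B i)) -> measurable (box B).
Proof.
move=> mB; have -> : box B = \bigcap_(i in [set: 'I_n]) (@tnth n R ^~ i @^-1` B i).
  by apply/seteqP; split=> [t tB i _|t tB i]; exact: tB.
apply: fin_bigcap_measurable => // i _; rewrite -[X in measurable X]setTI.
exact: measurable_tnth.
Qed.

Lemma boxI n (B B' : 'I_n -> set R) : box B `&` box B' = box (fun i => B i `&` B' i).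
Proof.
apply/seteqP; split=> [t [tB tB'] i|t tB]; first by split; [exact: tB|exact: tB'].
by split=> i; have [] := tB i.
Qed.

(** The cylinders generating the product sigma-algebra are boxes with a single constrained
    coordinate. *)
Lemma measurable_boxE n :
  @measurable _ (n.-tuple R) =
  <<s [set A | exists2 B : 'I_n -> set R, (forall i, measurable (B i)) & A = box B] >>.
Proof.
apply/seteqP; split; last first.
  apply: smallest_sub; first exact: sigma_algebra_measurable.
  by move=> _ [B mB ->]; exact: measurable_box.
apply: smallest_sub; first exact: smallest_sigma_algebra.
elim/big_ind: _ => //; first by move=> X Y SX SY A [/SX|/SY].
move=> i _ _ [Y mY <-]; apply: sub_sigma_algebra.
exists (fun j => if j == i then Y else setT); first by move=> j; case: eqP.
rewrite setTI; apply/seteqP; split=> [t tY j|t /(_ i)]; last by rewrite eqxx.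
by case: eqP => // ->.
Qed.

Lemma lebesgue_tuple_box n (B : 'I_n -> set R) : (forall i, measurable (B i)) ->
  leb n (box B) = (\big[*%E/1%E]_(i < n) lebesgue_measure (B i))%E.
Proof.
elim: n B => [|n IHn] B mB.
  by rewrite big_ord0 /= diracE mem_set//; case.
rewrite big_ord_recl -IHn//.
have inordSE (i : 'I_n) : inord i.+1 = lift ord0 i :> 'I_n.+1.
  by apply: val_inj; rewrite /= inordK// ltnS.
have -> : box B = [set t | B ord0 (thead t) /\
    box (fun i => B (lift ord0 i)) [tuple of behead t]].
  apply/seteqP; split=> [t tB|t [t0 tS] i].
    split; first exact: tB.
    move=> i; have := tB (lift ord0 i).
    by rewrite tnth_behead inordSE.
  have [->//|] := eqVneq i ord0; rewrite eq_sym => /unlift_some[j -> _].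
  by have := tS j; rewrite tnth_behead inordSE.
have mbox : measurable (box (fun i : 'I_n => B (lift ord0 i))) by exact: measurable_box.
have E := pushforward_tcons_box
  [the {sigma_finite_measure set (n.-tuple R) -> \bar R} of leb n] (mB ord0) mbox.
exact E.
Qed.

Lemma unit_cubeE n : @unit_cube R n = box (fun=> `[0, 1]).
Proof. by apply/seteqP; split=> t tB i; have := tB i. Qed.

Lemma measurable_unit_cube n : measurable (@unit_cube R n).
Proof. by rewrite unit_cubeE; exact: measurable_box. Qed.

Lemma lebesgue_unit_itv : lebesgue_measure (`[0, 1] : set R) = 1%E.
Proof. by rewrite lebesgue_measure_itv /= lte_fin ltr01 oppr0 adde0. Qed.

Lemma lebesgue_unit_cube n : leb n (@unit_cube R n) = 1%E.
Proof.
rewrite unit_cubeE lebesgue_tuple_box//.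
by rewrite big1// => i _; exact: lebesgue_unit_itv.
Qed.

Section select.
Variables (v n : nat) (th : 'I_v -> 'I_n).
Hypothesis th_inj : injective th.

Definition select (x : n.-tuple R) : v.-tuple R := [tuple tnth x (th i) | i < v].

Lemma measurable_select : measurable_fun [set: n.-tuple R] select.
Proof.
apply/measurable_fun_tnthP => i.
rewrite (_ : _ \o _ = @tnth n R ^~ (th i)); first exact: measurable_tnth.
by apply/funext => x /=; rewrite tnth_mktuple.
Qed.

Let mun := mrestr (leb n) (@measurable_unit_cube n).
Let muv := mrestr (leb v) (@measurable_unit_cube v).
Let nu : {measure set (v.-tuple R) -> \bar R} :=
  measure_function_pushforward__canonical__measure_function_Measure
    [the {measure set _ -> \bar R} of mun] measurable_select.

(** Both measures are finite and agree on boxes, which form a generating class stable under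
    intersection; each unselected coordinate contributes a factor 1. *)
Lemma pushforward_select A : measurable A -> nu A = muv A.
Proof.
apply: (measure_unique
  [set A | exists2 B : 'I_v -> set R, (forall i, measurable (B i)) & A = box B]
  (fun=> setT)).
- exact: measurable_boxE.
- move=> _ _ [B mB ->] [B' mB' ->]; exists (fun i => B i `&` B' i); last exact: boxI.
  by move=> i; exact: measurableI.
- by move=> _; exists (fun=> setT) => //; apply/seteqP; split.
- by rewrite bigcup_const//; exists 0%N.
- move=> _ [B mB ->].
  (* By injectivity of [th], a coordinate carries at most one constraint, and [B' j] is everything
     when [j] is not selected. *)
  pose B' (j : 'I_n) : set R := [set x | forall i, th i = j -> B i x].
  have mB' j : measurable (B' j).
    rewrite (_ : B' j = \bigcap_(i in [set i | th i = j]) B i); last first.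
      by apply/seteqP; split=> x Bx i; exact: Bx.
    exact: fin_bigcap_measurable.
  have B'E i : B' (th i) = B i.
    by apply/seteqP; split=> [x|x Bx k /th_inj ->//]; exact.
  have B'T j : (forall i, th i <> j) -> B' j = setT.
    by move=> jN; apply/seteqP; split=> // x _ i /jN.
  rewrite /nu /= /pushforward /muv /mun /mrestr !unit_cubeE.
  have -> : select @^-1` box B = box B'.
    apply/seteqP; split=> [t tB j i <-|t tB i]; rewrite /= .
      by have := tB i; rewrite tnth_mktuple.
    by rewrite tnth_mktuple -B'E.
  rewrite !boxI !lebesgue_tuple_box; last 2 first.
  - by move=> i; exact: measurableI.
  - by move=> i; exact: measurableI.
  rewrite (bigID (fun j => j \in codom th)) /= [X in (_ * X)%E]big1 ?mule1; last first.
    move=> j jN; rewrite B'T ?setTI ?lebesgue_unit_itv// => i ij.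
    by move: jN; rewrite -ij codom_f.
  rewrite (eq_bigl (mem (th @: [set: 'I_v])%SET)); last first.
    move=> j; apply/codomP/imsetP => [[i ->]|[i _ ->]]; last by exists i.
    by exists i.
  rewrite big_imset /=; last by move=> i k _ _ /th_inj.
  by apply: eq_big => [i|i _]; rewrite ?inE// B'E.
move=> _; rewrite /nu /= /pushforward /mun /mrestr preimage_setT setTI.
by rewrite lebesgue_unit_cube ltry.
Qed.

Lemma integral_select (f : v.-tuple R -> R) :
  measurable_fun (@unit_cube R v) f ->
  (forall y, @unit_cube R v y -> 0 <= f y) ->
  (\int[leb n]_(x in @unit_cube R n) f (select x) =
   \int[leb v]_(y in @unit_cube R v) f y)%R.
Proof.
move=> mf f0; congr fine; apply: esym.
have mcn := @measurable_unit_cube n; have mcv := @measurable_unit_cube v.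
rewrite (eq_measure_integral nu) => [|A mA Acube]; last first.
  by rewrite pushforward_select// /muv /mrestr setIidl.
rewrite [LHS](ge0_integral_pushforward measurable_select)//; last 2 first.
- exact/measurable_EFinP.
- by move=> y /set_mem yc; rewrite lee_fin f0.
have mD : measurable (select @^-1` @unit_cube R v).
  by rewrite -[X in measurable X]setTI; exact: measurable_select.
have sub : @unit_cube R n `<=` select @^-1` @unit_cube R v.
  by move=> x xc i; rewrite tnth_mktuple; exact: xc.
have mfs : measurable_fun (select @^-1` @unit_cube R v) (EFin \o f \o select).
  apply/measurable_EFinP; apply: (measurable_comp mcv) => //.
    by move=> _ [x xc <-].
  exact: measurable_funTS measurable_select.
(* The pushed-forward integral runs over the preimage of the small cube, which exceeds the large
   cube by a set that is null for the restricted measure. *)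
rewrite (ge0_negligible_integral (N := ~` @unit_cube R n))//; last 3 first.
- exact: measurableC.
- by move=> x xc; rewrite lee_fin f0.
- by rewrite /= /mun /mrestr setICl measure0.
rewrite setDE setCK setIidr//.
by apply: eq_measure_integral => A mA Ac; rewrite /= /mun /mrestr setIidl.
Qed.

End select.
End boxes.

(** * Sampling *)

Section cube_integral.
Variable R : realType.
Local Open Scope classical_set_scope.
Local Notation leb n := (@lebesgue_tuple R n).
Local Notation cube n := (@unit_cube R n).

Lemma cube_integrable n (f : n.-tuple R -> R) (M : R) :
  measurable_fun (cube n) f -> (forall x, cube n x -> `|f x| <= M) ->
  (leb n).-integrable (cube n) (EFin \o f).
Proof.
move=> mf fM; apply: measurable_bounded_integrable => //.
- exact: measurable_unit_cube.
- by rewrite [X in (X < _)%E]lebesgue_unit_cube ltry.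
exists M; split; first exact: num_real.
by move=> y My x xc; apply: (le_trans (fM _ xc)); exact: ltW.
Qed.

Lemma cube_integral_cst n (r : R) : (\int[leb n]_(x in cube n) r)%R = r.
Proof.
rewrite Rintegral_cst; last exact: measurable_unit_cube.
by rewrite [X in fine X]lebesgue_unit_cube mulr1.
Qed.

Lemma cube_integral_sum n (I : finType) (f : I -> n.-tuple R -> R) :
  (forall i, (leb n).-integrable (cube n) (EFin \o f i)) ->
  (\int[leb n]_(x in cube n) (\sum_i f i x))%R =
  \sum_i (\int[leb n]_(x in cube n) f i x)%R.
Proof.
move=> fi; have mc := @measurable_unit_cube R n.
suff [_ ->//] : (leb n).-integrable (cube n)
    (EFin \o (fun x => \sum_(i <- index_enum I) f i x)) /\
  (\int[leb n]_(x in cube n) (\sum_(i <- index_enum I) f i x))%R =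
  \sum_(i <- index_enum I) (\int[leb n]_(x in cube n) f i x)%R.
elim: (index_enum I) => [|i s [IHi IHs]].
  rewrite big_nil; under eq_Rintegral do rewrite big_nil.
  rewrite cube_integral_cst; split=> //.
  by under eq_fun do rewrite big_nil; apply: (@cube_integrable _ _ 0) => // x _; rewrite normr0.
rewrite big_cons; under eq_Rintegral do rewrite big_cons.
rewrite RintegralD// IHs; split=> //.
rewrite (_ : _ \o _ = (EFin \o f i) \+ (EFin \o (fun x => (\sum_(i <- s) f i x)%R)))%E.
  exact: integrableD.
by apply/funext => x /=; rewrite big_cons EFinD.
Qed.

Section sampling.
Variable W : R * R -> R.
Hypothesis W_graphon : graphon W.
Local Notation cW := (fun a b => W (a, b)).

Let W01 n (x : n.-tuple R) i j : cube n x -> 0 <= W (tnth x i, tnth x j) <= 1.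
Proof. by move=> xc; have [_ W01 _] := W_graphon; apply: W01; exact: xc. Qed.

Lemma measurable_sample (H : sgraph) n (phi : H -> 'I_n) :
  measurable_fun (cube n) (fun x : n.-tuple R => hom_weight cW (fun u => tnth x (phi u))).
Proof.
have [mW _ _] := W_graphon; have mc := @measurable_unit_cube R n.
rewrite /hom_weight; under eq_fun do rewrite -big_enum.
apply: measurable_prod => -[u v] _ /=.
apply: (@measurable_comp _ _ _ _ _ _ (`[0 : R, 1] `*` `[0 : R, 1]) W _
  (fun x : n.-tuple R => (tnth x (phi u), tnth x (phi v)))) => //.
- exact: measurableX.
- by move=> _ [x xc <-]; split; exact: xc.
- by apply: measurable_funTS; apply: measurable_fun_pair; exact: measurable_tnth.
Qed.

Lemma sample_itv (H : sgraph) n (phi : H -> 'I_n) (x : n.-tuple R) : cube n x ->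
  0 <= hom_weight cW (fun u => tnth x (phi u)) <= 1.
Proof.
move=> xc; have WP uv := W01 (phi uv.1) (phi uv.2) xc.
apply/andP; split; first by apply: prodr_ge0 => uv _; have /andP[] := WP uv.
by apply: prodr_ile1 => uv _; exact: WP.
Qed.

Lemma sample_integrable (H : sgraph) n (phi : H -> 'I_n) :
  (leb n).-integrable (cube n)
    (EFin \o (fun x : n.-tuple R => hom_weight cW (fun u => tnth x (phi u)))).
Proof.
apply: (cube_integrable (M := 1)); first exact: measurable_sample.
by move=> x xc; have /andP[w0 w1] := sample_itv phi xc; rewrite ger0_norm.
Qed.

Lemma sample_integral_le1 (H : sgraph) n (phi : H -> 'I_n) :
  (\int[leb n]_(x in cube n) hom_weight cW (fun u => tnth x (phi u)))%R <= 1.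
Proof.
rewrite -[leRHS](@cube_integral_cst n 1); apply: le_Rintegral.
- exact: measurable_unit_cube.
- exact: sample_integrable.
- by apply: (cube_integrable (M := 1)) => // x _; rewrite normr1.
by move=> x xc; have /andP[] := sample_itv phi xc.
Qed.

Lemma hom_density_ge0 (H : sgraph) : 0 <= hom_density H W.
Proof. by apply: Rintegral_ge0 => x xc; have /andP[] := sample_itv (@enum_rank H) xc. Qed.

Lemma sample_integral_inj (H : sgraph) n (phi : H -> 'I_n) : injective phi ->
  (\int[leb n]_(x in cube n) hom_weight cW (fun u => tnth x (phi u)))%R =
  hom_density H W.
Proof.
move=> phi_inj; pose th (i : 'I_#|H|) := phi (enum_val i).
have th_inj : injective th by move=> i j /phi_inj/enum_val_inj.
rewrite /hom_density -(integral_select th_inj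
  (f := fun x => hom_weight cW (fun u => tnth x (enum_rank u)))).
- apply: eq_Rintegral => x _; apply: eq_hom_weight => u.
  by rewrite tnth_mktuple /th enum_rankK.
- exact: measurable_sample.
by move=> y yc; have /andP[] := sample_itv (@enum_rank H) yc.
Qed.

(** The fraction of noninjective maps is at most [v^2 / n], stated without subtraction or
    division. *)
Lemma expn_le_ffact n v : (n * n ^ v <= n * n ^_ v + v * v * n ^ v)%N.
Proof.
elim: v => [|v IHv]; first by rewrite ffactn0; lia.
have ff : (n ^_ v <= n ^ v)%N.
  elim: (v) => [|w IHw]; first by rewrite ffactn0.
  by rewrite ffactnSr expnSr leq_mul// leq_subr.
rewrite ffactnSr expnSr.
have : (n ^_ v * n <= n ^_ v * (n - v) + v * n ^_ v)%N.
  by rewrite [(v * _)%N]mulnC -mulnDr leq_mul2l; apply/orP; right; lia.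
move: (n ^ v)%N (n ^_ v)%N (n ^_ v * (n - v))%N IHv ff => X F G IHv ff FG.
have := leq_mul (leqnn n) IHv; have := leq_mul (leqnn n) FG.
have := leq_mul (leqnn (n * v)) ff; nia.
Qed.

(** Injective maps contribute the density itself; the others contribute at most 1 each, and
    [expn_le_ffact] bounds their number. *)
Lemma sum_sample_integral_le (H : sgraph) n : (0 < n)%N ->
  (\sum_(phi : {ffun H -> 'I_n})
    (\int[leb n]_(x in cube n) hom_weight cW (fun u => tnth x (phi u)))%R) /
    n%:R ^+ #|H| <= hom_density H W + (#|H| * #|H|)%:R / n%:R.
Proof.
move=> n_gt0; have n0 : 0 < n%:R :> R by rewrite ltr0n.
have nv0 : 0 < n%:R ^+ #|H| :> R by rewrite exprn_gt0.
rewrite ler_pdivrMr//.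
pose N := #|[pred phi : {ffun H -> 'I_n} | ~~ injectiveb phi]|.
have NE : (N + n ^_ #|H| = n ^ #|H|)%N.
  rewrite -{1}[n]card_ord -card_inj_ffuns addnC -[in RHS](card_ord n) -card_ffun.
  rewrite -(cardsC [set f : {ffun H -> 'I_n} | injectiveb f]%SET); congr (_ + _)%N.
  by apply: eq_card => phi; rewrite !inE.
apply: (@le_trans _ _ (hom_density H W * n%:R ^+ #|H| + N%:R)).
  rewrite (bigID (fun phi : {ffun H -> 'I_n} => injectiveb phi)) /= lerD//.
    rewrite (eq_bigr (fun=> hom_density H W)); last first.
      by move=> phi /injectiveP phi_inj; exact: sample_integral_inj.
    rewrite sumr_const -[leLHS]mulr_natr ler_wpM2l ?hom_density_ge0// -natrX ler_nat.
    by rewrite -[X in (X ^ _)%N]card_ord -card_ffun max_card.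
  rewrite /N -sum1_card natr_sum; apply: ler_sum => phi _.
  exact: sample_integral_le1.
rewrite mulrDl lerD2l mulrAC ler_pdivlMr// -!natrX -!natrM ler_nat.
have := expn_le_ffact n #|H|; rewrite -[in X in (X <= _)%N]NE.
rewrite mulnDr [(n * N)%N]mulnC addnC leq_add2l; exact.
Qed.

End sampling.

Lemma common_of_finite (H1 H2 : sgraph) (W1 W2 : R * R -> R) (k1 k2 beta : R) :
  graphon W1 -> graphon W2 ->
  (forall x y, x \in `[0, 1]%R -> y \in `[0, 1]%R -> W1 (x, y) + W2 (x, y) = 1) ->
  0 < k1 -> 0 < k2 ->
  (forall n (A1 A2 : 'M[R]_n), (0 < n)%N ->
     (forall x y, A1 x y = A1 y x) ->
     (forall x y, 0 <= A1 x y) -> (forall x y, 0 <= A2 x y) ->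
     (forall x y, A1 x y + A2 x y = 1) ->
     beta <=
     (\sum_(phi : {ffun H1 -> 'I_n}) hom_weight A1 phi) / n%:R ^+ num_vertices H1 / k1 +
     (\sum_(phi : {ffun H2 -> 'I_n}) hom_weight A2 phi) / n%:R ^+ num_vertices H2 / k2) ->
  beta <= hom_density H1 W1 / k1 + hom_density H2 W2 / k2.
Proof.
move=> g1 g2 W12 k1_gt0 k2_gt0 fin.
pose w1 n (phi : {ffun H1 -> 'I_n}) (x : n.-tuple R) :=
  hom_weight (fun a b => W1 (a, b)) (fun u => tnth x (phi u)).
pose w2 n (phi : {ffun H2 -> 'I_n}) (x : n.-tuple R) :=
  hom_weight (fun a b => W2 (a, b)) (fun u => tnth x (phi u)).
pose d1 n : R := n%:R ^+ num_vertices H1 * k1.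
pose d2 n : R := n%:R ^+ num_vertices H2 * k2.
have int_le n : (0 < n)%N -> beta <=
    (d1 n)^-1 * (\sum_phi \int[leb n]_(x in cube n) w1 n phi x) +
    (d2 n)^-1 * (\sum_phi \int[leb n]_(x in cube n) w2 n phi x).
  move=> n_gt0; have mc := @measurable_unit_cube R n.
  have i1 phi : (leb n).-integrable (cube n) (EFin \o w1 n phi).
    exact: sample_integrable.
  have i2 phi : (leb n).-integrable (cube n) (EFin \o w2 n phi).
    exact: sample_integrable.
  have sumi (I : finType) (f : I -> n.-tuple R -> R) (c : R) :
      (forall i, (leb n).-integrable (cube n) (EFin \o f i)) ->
      (leb n).-integrable (cube n) (EFin \o (fun x => c * \sum_i f i x)).
    move=> fi; rewrite (_ : _ \o _ =
      (fun x => c%:E * (\sum_(i <- index_enum I | true) (EFin \o f i) x))%E).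
      by apply: integrableZl => //; apply: integrable_sum.
    by apply/funext => x /=; rewrite EFinM sumEFin.
  rewrite -!cube_integral_sum// -!RintegralZl//; last 2 first.
  - by have := sumi _ (w2 n) 1 i2; under [X in _ \o X]eq_fun do rewrite mul1r.
  - by have := sumi _ (w1 n) 1 i1; under [X in _ \o X]eq_fun do rewrite mul1r.
  rewrite -RintegralD//; [|exact: sumi|exact: sumi].
  rewrite -[leLHS](@cube_integral_cst n beta); apply: le_Rintegral => //.
  - by apply: (cube_integrable (M := `|beta|)).
  - rewrite (_ : _ \o _ = (EFin \o (fun x => ((d1 n)^-1 * \sum_phi w1 n phi x)%R)) \+
       (EFin \o (fun x => ((d2 n)^-1 * \sum_phi w2 n phi x)%R)))%E//.
    by apply: integrableD => //; exact: sumi.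
  move=> x xc.
  have [_ W01 Wsym] := g1; have [_ W01' _] := g2.
  pose A1 : 'M[R]_n := \matrix_(i, j) W1 (tnth x i, tnth x j).
  pose A2 : 'M[R]_n := \matrix_(i, j) W2 (tnth x i, tnth x j).
  have := fin n A1 A2 n_gt0.
  have -> : \sum_(phi : {ffun H1 -> 'I_n}) hom_weight A1 phi = \sum_phi w1 n phi x.
    by apply: eq_bigr => phi _; apply: eq_bigr => uv _; rewrite mxE.
  have -> : \sum_(phi : {ffun H2 -> 'I_n}) hom_weight A2 phi = \sum_phi w2 n phi x.
    by apply: eq_bigr => phi _; apply: eq_bigr => uv _; rewrite mxE.
  rewrite -!mulrA -!invfM ![_ / _]mulrC; apply.
  - by move=> i j; rewrite !mxE Wsym//; exact: xc.
  - by move=> i j; rewrite mxE; have /andP[] := W01 _ _ (xc i) (xc j).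
  - by move=> i j; rewrite mxE; have /andP[] := W01' _ _ (xc i) (xc j).
  - by move=> i j; rewrite !mxE W12//; exact: xc.
pose K : R := (#|H1| * #|H1|)%:R / k1 + (#|H2| * #|H2|)%:R / k2.
have K0 : 0 <= K by rewrite addr_ge0// divr_ge0// ?ler0n// ltW.
have bound n : (0 < n)%N ->
    beta - (hom_density H1 W1 / k1 + hom_density H2 W2 / k2) <= K / n%:R.
  move=> n_gt0; have n0 : 0 < n%:R :> R by rewrite ltr0n.
  have := int_le n n_gt0.
  have := sum_sample_integral_le g1 H1 n_gt0; have := sum_sample_integral_le g2 H2 n_gt0.
  rewrite -(ler_pM2r (_ : 0 < k2^-1)) ?invr_gt0// => le2.
  rewrite -(ler_pM2r (_ : 0 < k1^-1)) ?invr_gt0// => le1.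
  rewrite /d1 /d2 !invfM => le0; rewrite lerBlDl.
  apply: (le_trans le0); move: (lerD le1 le2) => le12.
  rewrite -[_^-1 * _^-1 * _]mulrC [_^-1 * _^-1 * \sum_phi _]mulrC !mulrA.
  apply: (le_trans le12); rewrite /K le_eqVlt; apply/orP; left; apply/eqP; ring.
(* A positive gap [g] would be at most [K / n] for every [n], which fails once [n] exceeds
   [K / g]. *)
rewrite -subr_le0 leNgt; apply/negP => gap.
set g := beta - _ in gap bound.
have [n nP] : exists n : nat, K / g < n%:R.
  by exists (Num.bound (K / g)); rewrite archi_boundP// divr_ge0// ltW.
have n_gt0 : (0 < n)%N.
  by rewrite -(ltr0n R) (le_lt_trans _ nP)// divr_ge0// ltW.
have := bound n n_gt0; rewrite leNgt => /negP; apply.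
by rewrite ltr_pdivrMr ?ltr0n// mulrC -ltr_pdivrMr.
Qed.

End cube_integral.

(** * Sign graphons *)

Section sign_graphon.
Variable R : realType.
Local Open Scope classical_set_scope.
Local Notation leb n := (@lebesgue_tuple R n).
Local Notation cube n := (@unit_cube R n).

Definition half (x : R) : 'I_2 := if x < 2^-1 then ord0 else ord_max.

Definition sign_graphon (p e : R) (xy : R * R) : R :=
  sign_mx p e (half xy.1) (half xy.2).

Lemma measurable_half_preimage (j : 'I_2) : measurable (half @^-1` [set j]).
Proof.
have E0 : half @^-1` [set ord0] = `]-oo, 2^-1[.
  by apply/seteqP; split=> x; rewrite /= /half in_itv /=; case: ifP.
case: j => -[|[|//]] j2.
  by rewrite (_ : Ordinal j2 = ord0) ?E0//; apply: val_inj.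
rewrite (_ : Ordinal j2 = ord_max); last exact: val_inj.
rewrite (_ : half @^-1` _ = ~` (half @^-1` [set ord0])).
  by apply: measurableC; rewrite E0.
by apply/seteqP; split=> x; rewrite /= /half; case: ifP.
Qed.

Lemma lebesgue_half (j : 'I_2) :
  lebesgue_measure (half @^-1` [set j] `&` `[0, 1]) = (2^-1)%:E.
Proof.
case: j => -[|[|//]] j2.
  rewrite (_ : Ordinal j2 = ord0); last exact: val_inj.
  rewrite (_ : _ `&` _ = `[0, 2^-1[); last first.
    apply/seteqP; split=> x; rewrite /= /half !in_itv /=.
      by case: ifP => x2 [/(congr1 val)//= _ /andP[x0 x1]]; rewrite x0.
    by move=> /andP[-> x2]; rewrite x2; split=> //; lra.
  by rewrite lebesgue_measure_itv /= lte_fin invr_gt0 ltr0n oppr0 adde0.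
rewrite (_ : Ordinal j2 = ord_max); last exact: val_inj.
rewrite (_ : _ `&` _ = `[2^-1, 1]); last first.
  apply/seteqP; split=> x; rewrite /= /half !in_itv /=.
    case: ifP => x2 [/(congr1 val)//= _ /andP[x0 x1]].
    by rewrite x1 leNgt x2.
  by move=> /andP[x2 ->]; rewrite ltNge x2; split=> //; lra.
rewrite lebesgue_measure_itv /= lte_fin invf_lt1 ?ltr0n// ltr1n /=.
by rewrite -EFinD; congr EFin; lra.
Qed.

Lemma sign_graphonP (p e : R) : `|e| < p -> `|e| < 1 - p -> graphon (sign_graphon p e).
Proof.
move=> ep ep1; split.
- apply: measurable_funTS; rewrite /sign_graphon.
  have ms : measurable_fun [set: R] (fun x => spin R (half x)).
    rewrite (_ : (fun x => _) = (fun x => if x < 2^-1 then 1 else -1 : R)).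
      apply: measurable_fun_ifT => //.
      by apply: measurable_fun_ltr.
    by apply/funext => x; rewrite /half /spin; case: ifP; rewrite ?expr0 ?expr1.
  under eq_fun do rewrite mxE.
  apply: measurable_funD => //; apply: measurable_funM => //.
  by apply: measurable_funM; apply: (measurableT_comp ms).
- move=> x y _ _; rewrite /sign_graphon /= ltW ?sign_mx_gt0//=.
  (* The upper bound 1 is the positivity of the complementary sign matrix. *)
  have := @sign_mx_gt0 R (1 - p) (- e) (half x) (half y).
  by rewrite normrN => /(_ ep1); rewrite !mxE mulNr; lra.
- by move=> x y _ _; exact: sign_mx_sym.
Qed.

(** The cube splits into [2 ^+ #|H|] boxes of equal volume, one for each configuration of halves,
    and the integrand is constant on each of them. *)
Lemma hom_density_sign_graphon (H : sgraph) (p e : R) :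
  hom_density H (sign_graphon p e) =
  (\sum_(phi : {ffun H -> 'I_2}) hom_weight (sign_mx p e) phi) / 2 ^+ #|H|.
Proof.
set A := sign_mx p e; pose B (phi : {ffun H -> 'I_2}) : set (#|H|.-tuple R) :=
  box (fun i => half @^-1` [set phi (enum_val i)]).
have mB phi : measurable (B phi).
  by apply: measurable_box => i; exact: measurable_half_preimage.
have mc := @measurable_unit_cube R #|H|.
have iB phi : (leb #|H|).-integrable (cube #|H|) (EFin \o (\1_(B phi) : _ -> R)).
  apply: (cube_integrable (M := 1)); first exact: measurable_indic.
  by move=> x _; rewrite indicE; case: (_ \in _); rewrite ?normr1 ?normr0.
have lebB phi : leb #|H| (B phi `&` cube #|H|) = ((2 ^+ #|H|)^-1)%:E.
  rewrite unit_cubeE boxI lebesgue_tuple_box; last first.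
    by move=> i; apply: measurableI => //; exact: measurable_half_preimage.
  under eq_bigr do rewrite lebesgue_half.
  rewrite -exprVn; elim: #|H| => [|k IHk]; first by rewrite big_ord0.
  by rewrite big_ord_recl IHk exprS EFinM.
have intB phi : (\int[leb #|H|]_(x in cube #|H|) (\1_(B phi) x))%R = (2 ^+ #|H|)^-1.
  by rewrite /Rintegral integral_indic// [X in fine X]lebB.
rewrite /hom_density mulr_suml.
under [RHS]eq_bigr => phi _ do rewrite -(intB phi) -RintegralZl//.
rewrite -cube_integral_sum; last first.
  move=> phi; rewrite (_ : _ \o _ =
    (fun x => (hom_weight A phi)%:E * (EFin \o \1_(B phi)) x)%E) //.
  exact: integrableZl.
apply: eq_Rintegral => x _.
pose phx : {ffun H -> 'I_2} := [ffun u => half (tnth x (enum_rank u))].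
rewrite [RHS](bigD1 phx)//= [X in _ + X]big1 ?addr0 => [|phi phiN].
  rewrite indicE mem_set ?mulr1; last by move=> i /=; rewrite ffunE enum_valK.
  by rewrite /hom_weight; apply: eq_bigr => uv _; rewrite !ffunE.
rewrite indicE memNset ?mulr0// => xB; move/eqP: phiN; apply; apply/ffunP => u.
by rewrite ffunE (xB (enum_rank u)) enum_rankK.
Qed.

End sign_graphon.

(** * Comparison of the terms of order [m], and the equivalence *)

Lemma poly_bounded (R : realType) (S : {poly R}) :
  exists M, forall x, `|x| <= 1 -> `|S.[x]| <= M.
Proof.
elim/poly_ind: S => [|S c [M SM]].
  by exists 0 => x _; rewrite horner0 normr0.
exists (M + `|c|) => x x1; rewrite hornerMXaddC.
rewrite (le_trans (ler_normD _ _))// lerD2r normrM.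
by apply: le_trans (SM x x1); rewrite ler_piMr.
Qed.

Lemma odd_expansion_eq0 (R : realType) (m : nat) (c d : R) (S : {poly R}) :
  odd m -> 0 < d ->
  (forall e, `|e| < d -> 0 <= c * e ^+ m + e ^+ m.+1 * S.[e]) -> c = 0.
Proof.
move=> m_odd d0 H.
have [M SM] := poly_bounded S; apply/eqP/negPn/negP => c0.
have M0 : 0 <= M by apply: le_trans (SM 0 _); rewrite ?normr0.
have nc0 : 0 < `|c| by rewrite normr_gt0.
(* Small enough for the hypothesis, for the bound [M] on [S], and for the term of order [m] to
   dominate; [M + 1] keeps the denominator positive. *)
pose t := Num.min (Num.min d 1) (`|c| / (M + 1)) / 2.
have M1 : 0 < M + 1 by rewrite ltr_wpDl.
have min0 : 0 < Num.min (Num.min d 1) (`|c| / (M + 1)).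
  by rewrite !lt_min d0 ltr01 divr_gt0.
have t0 : 0 < t by rewrite divr_gt0.
have tlt : t < Num.min (Num.min d 1) (`|c| / (M + 1)) by rewrite /t; lra.
have [td t1 tc] : [/\ t < d, t < 1 & t < `|c| / (M + 1)].
  by move: tlt; rewrite !lt_min => /andP[/andP[-> ->] ->].
(* As [m] is odd, this sign makes [c * e ^+ m] negative. *)
pose e := - (Num.sg c) * t.
have ne : `|e| = t by rewrite /e normrM normrN normr_sg c0 mul1r gtr0_norm.
have cem : c * e ^+ m = - (`|c| * t ^+ m).
  have sgX : Num.sg c ^+ m = Num.sg c.
    rewrite -[m in LHS](odd_double_half m) m_odd add1n exprS -mul2n exprM.
    by rewrite sqr_sg c0 expr1n mulr1.
  have -> : e ^+ m = - Num.sg c * t ^+ m.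
    by rewrite /e exprMn exprNn sgX -signr_odd m_odd expr1 mulN1r.
  by rewrite [in RHS]normrEsg; ring.
have := H e; rewrite ne td cem => /(_ isT).
rewrite leNgt => /negP; apply.
have : e ^+ m.+1 * S.[e] <= t ^+ m.+1 * M.
  apply: (le_trans (ler_norm _)); rewrite normrM normrX ne ler_wpM2l//.
    by rewrite exprn_ge0// ltW.
  by apply: SM; rewrite ne ltW.
have : t ^+ m.+1 * M < `|c| * t ^+ m.
  rewrite exprS mulrAC ltr_pM2r ?exprn_gt0//.
  move: tc; rewrite ltr_pdivlMr//; nra.
lra.
Qed.

Lemma expansion_condition (R : realType) (m : nat) (H1 H2 : sgraph) (p1 p2 : R)
    (k1 k2 : nat) :
  odd m -> (m <= num_edges H1)%N -> (m <= num_edges H2)%N ->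
  0 < p1 < 1 -> 0 < p2 < 1 -> p1 + p2 = 1 ->
  expands R m H1 k1 -> expands R m H2 k2 ->
  common_pair p1 p2 H1 H2 ->
  k1%:R / ((num_edges H1)%:R * p1 ^+ (m - 1)) =
  k2%:R / ((num_edges H2)%:R * p2 ^+ (m - 1)).
Proof.
move=> m_odd mE1 mE2 /andP[p1_gt0 _] /andP[p2_gt0 _] p12 exp1 exp2 [e1_gt0 e2_gt0 common].
have [Q1 Q1E] := exp1 p1 p1_gt0; have [Q2 Q2E] := exp2 p2 p2_gt0.
have m_gt0 : (0 < m)%N by exact: odd_gt0.
(* Normalising sends the constant term to [p / E], which cancels against the right side of the
   inequality, and turns the coefficient of order [m] into a side of the desired equation. *)
have divE (E k : nat) (p x y : R) : (m <= E)%N -> 0 < p ->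
    (p ^+ E + k%:R * p ^+ (E - m) * x + y) / (E%:R * p ^+ (E - 1)) =
    p / E%:R + k%:R / (E%:R * p ^+ (m - 1)) * x + (E%:R * p ^+ (E - 1))^-1 * y.
  move=> mE p0; have E0 : E%:R != 0 :> R by rewrite pnatr_eq0; lia.
  have -> : p ^+ E = p * (p ^+ (E - m) * p ^+ (m - 1)).
    by rewrite -exprD -exprS; congr (_ ^+ _); lia.
  have -> : p ^+ (E - 1) = p ^+ (E - m) * p ^+ (m - 1).
    by rewrite -exprD; congr (_ ^+ _); lia.
  by field; rewrite E0 !gt_eqF ?exprn_gt0.
pose c1 : R := (num_edges H1)%:R * p1 ^+ (num_edges H1 - 1).
pose c2 : R := (num_edges H2)%:R * p2 ^+ (num_edges H2 - 1).
apply/eqP; rewrite -subr_eq0; apply/eqP.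
(* The second colour is perturbed by [- e], hence the composition with [- 'X]; the bound
   [Num.min p1 p2] ensures that both perturbed kernels are graphons. *)
apply: (@odd_expansion_eq0 R m _ (Num.min p1 p2)
  (c1^-1 *: Q1 + c2^-1 *: (Q2 \Po - 'X))) => //; first by rewrite lt_min p1_gt0.
move=> e; rewrite lt_min => /andP[ep1 ep2].
have p1E : 1 - p1 = p2 by rewrite -p12 addrC addKr.
have p2E : 1 - p2 = p1 by rewrite -p12 addrK.
have g1 : graphon (sign_graphon p1 e) by apply: sign_graphonP; rewrite ?p1E.
have g2 : graphon (sign_graphon p2 (- e)) by apply: sign_graphonP; rewrite normrN ?p2E.
have sum1 x y : x \in `[0, 1] -> y \in `[0, 1] ->
    sign_graphon p1 e (x, y) + sign_graphon p2 (- e) (x, y) = 1.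
  by move=> _ _; rewrite /sign_graphon !mxE -p12; ring.
have := common _ _ g1 g2 sum1; rewrite !hom_density_sign_graphon Q1E ?Q2E ?normrN//.
have two0 k : 2 ^+ k != 0 :> R by rewrite expf_neq0// pnatr_eq0.
have em : (- e) ^+ m = - e ^+ m by rewrite exprNn -signr_odd m_odd expr1 mulN1r.
have em1 : (- e) ^+ m.+1 = e ^+ m.+1 by rewrite exprS em mulrNN -exprS.
rewrite ![2 ^+ _ * _]mulrC !mulfK// !divE// em em1.
rewrite hornerD !hornerZ horner_comp hornerN hornerX -/c1 -/c2 -subr_ge0.
congr (0 <= _); ring.
Qed.

Theorem theorem1p6 (R : realType) (m : nat) (H1 H2 : sgraph) (p1 p2 : R)
    (m_ge3 : (3 <= m)%N) (m_odd : odd m)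
    (treeH1 : simple_cycle_tree m H1) (treeH2 : simple_cycle_tree m H2)
    (p1_itv : 0 < p1 < 1) (p2_itv : 0 < p2 < 1) (p1Dp2 : p1 + p2 = 1) :
  common_pair p1 p2 H1 H2 <->
  ((num_edges H1)%:R - (num_vertices H1)%:R + 1) /
    ((num_edges H1)%:R * p1 ^+ (m - 1)) =
  ((num_edges H2)%:R - (num_vertices H2)%:R + 1) /
    ((num_edges H2)%:R * p2 ^+ (m - 1)).
Proof.
have m_gt0 : (0 < m)%N by exact: odd_gt0.
have [a1 [b1 [E1 V1 _ exp1]]] := cycle_tree_facts R m_ge3 treeH1.
have [a2 [b2 [E2 V2 _ exp2]]] := cycle_tree_facts R m_ge3 treeH2.
have mE1 := cycle_tree_edges_ge m_gt0 E1; have mE2 := cycle_tree_edges_ge m_gt0 E2.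
split=> [common|cond].
  rewrite (cycle_tree_euler R E1 V1) (cycle_tree_euler R E2 V2).
  exact: expansion_condition common.
have e1_gt0 := leq_trans m_gt0 mE1; have e2_gt0 := leq_trans m_gt0 mE2.
have [p1_gt0 _] := andP p1_itv; have [p2_gt0 _] := andP p2_itv.
split=> // W1 W2 g1 g2 W12.
apply: common_of_finite => //; first by rewrite mulr_gt0 ?exprn_gt0 ?ltr0n.
  by rewrite mulr_gt0 ?exprn_gt0 ?ltr0n.
by move=> n A1 A2 n_gt0 *; apply: (finite_common m_ge3).
Qed.
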